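(* Let $n\ge3$, let $\gamma$ be a weak composition with $n$ parts and let $\tau\in S_n$. The permuted basement nonsymmetric polynomial $E_{\gamma,\tau}(x_1,\dots,x_n;q,t)$ is a simultaneous eigenfunction of the operators $Y_1^\tau,\dots,Y_n^\tau$; that is, for each $1\le i\le n$ there is a scalar $c\in\mathbb{Q}(q,t)$ with $Y_i^\tau E_{\gamma,\tau}=c\,E_{\gamma,\tau}$.
   Context: Operators. On $\mathbb{Q}(q,t)[x_1^{\pm1},\dots,x_n^{\pm1}]$ define, for $0<i<n$, $T_if=t\,(s_if)+(t-1)\frac{f-s_if}{1-x_i/x_{i+1}}$, where $s_i$ exchanges $x_i,x_{i+1}$, and $\pi f(x_1,\dots,x_n)=f(x_2,\dots,x_n,q^{-1}x_1)$. Each $T_i$ is invertible (as $(T_i-t)(T_i+1)=0$). These are the actions of generators of the double affine Hecke algebra of type $A$ in Cherednik's representation. For $\tau\in S_n$ and $1\le i\le n$, $$Y_i^\tau=t^{\varepsilon_i^\tau}\,T_{i-1}^{\varepsilon_{i-1}}\cdots T_1^{\varepsilon_1}\,\pi\,T_{n-1}^{\varepsilon_{n-1}}\cdots T_i^{\varepsilon_i},$$ where $\varepsilon_j\in\{1,-1\}$ (depending on $i,\tau$) is given by: for $i\le j<n$, $\varepsilon_j=-1$ if $(i,j+1)$ form an inversion in $\tau$ and $\varepsilon_j=1$ otherwise; for $1\le j<i$, $\varepsilon_j=1$ if $(j,i)$ form an inversion in $\tau$ and $\varepsilon_j=-1$ otherwise; and $\varepsilon_i^\tau=|\{1\le j\le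 n-1:\varepsilon_j=-1\}|$. Here, for values $a<b$, ''$(a,b)$ form an inversion in $\tau$'' means that $b$ appears to the left of $a$ in the one-line notation $\tau(1)\cdots\tau(n)$, i.e. $\tau^{-1}(a)>\tau^{-1}(b)$. Diagrams. $\mathrm{dg}(\gamma)=\{(i,j):1\le i\le n,\ 1\le j\le\gamma_i\}$, $i$ indexing columns (left to right) and $j$ rows (bottom to top); $\widehat{\mathrm{dg}}(\gamma)$ adds the boxes $(i,0)$, $1\le i\le n$. For $u=(i,j)\in\mathrm{dg}(\gamma)$: $d(u)=(i,j-1)$, $l(u)=\gamma_i-j$, $\mathrm{arm}(u)=\{(i',j)\in\mathrm{dg}(\gamma):i'<i,\gamma_{i'}\le\gamma_i\}\sqcup\{(i',j-1)\in\widehat{\mathrm{dg}}(\gamma):i'>i,\gamma_{i'}<\gamma_i\}$, $a(u)=|\mathrm{arm}(u)|$. For a filling $\sigma\colon\mathrm{dg}(\gamma)\to[n]$, the augmented filling $\widehat\sigma^\tau\colon\widehat{\mathrm{dg}}(\gamma)\to[n]$ agrees with $\sigma$ on $\mathrm{dg}(\gamma)$ and has $\widehat\sigma^\tau((j,0))=\tau(j)$. Two boxes are attacking if they are in the same row, or they are in consecutive rows and the box in the higher row is strictly to the left of the box in the lower row. $\widehat\sigma^\tau$ is non-attacking if attacking boxes always have different entries. $\mathrm{maj}(\widehat\sigma^\tau)=\sum(l(u)+1)$ over $u\in\mathrm{dg}(\gamma)$ with $\widehat\sigma^\tau(u)>\widehat\sigma^\tau(d(u))$. A triple is $(u,v,w)$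 with $u\in\mathrm{dg}(\gamma)$, $w=d(u)$, $v\in\mathrm{arm}(u)$. With $\chi_{xy}=1$ if $\widehat\sigma^\tau(x)>\widehat\sigma^\tau(y)$ and $0$ otherwise, $\chi_{uv}+\chi_{vw}-\chi_{uw}\in\{0,1\}$, and the triple is a coinversion triple if this quantity is $0$; $\mathrm{Coinvtrip}(\widehat\sigma^\tau)$ is the number of coinversion triples. Definition: $$E_{\gamma,\tau}(\mathbf{x};q,t)=\sum_{\sigma}\mathbf{x}^\sigma q^{\mathrm{maj}(\widehat\sigma^\tau)}t^{\mathrm{Coinvtrip}(\widehat\sigma^\tau)}\prod_{\substack{u\in\mathrm{dg}(\gamma)\\ \widehat\sigma^\tau(u)\ne\widehat\sigma^\tau(d(u))}}\frac{1-t}{1-q^{l(u)+1}t^{a(u)+1}},$$ the sum over $\sigma\colon\mathrm{dg}(\gamma)\to[n]$ with $\widehat\sigma^\tau$ non-attacking, $\mathbf{x}^\sigma=\prod_{u\in\mathrm{dg}(\gamma)}x_{\sigma(u)}$. *)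

(* Defs.v *)
From HB Require Import structures.
From mathcomp Require Import all_boot all_order all_fingroup all_algebra.
From mathcomp.multinomials Require Export mpoly.
From mathcomp Require Import ring.

Set Implicit Arguments.
Unset Strict Implicit.
Unset Printing Implicit Defensive.

Import GRing.Theory.
Local Open Scope ring_scope.

Notation "x %:F" := (@FracField.tofrac _ x) (format "x %:F") : ring_scope.

Definition ratfun (F : fieldType) (n : nat) : fieldType :=
  {fraction {mpoly F[n]}}.
Definition of_mpoly (F : fieldType) (n : nat) (p : {mpoly F[n]}) : ratfun F n :=
  p%:F.

(** Throughout, indices are 0-based: [i : 'I_n] stands for the mathematical
    index [i + 1], for variables, columns, entries and operators alike. *)

(** The operators of Cherednik's representation are given on the field
    [F(x_1, ..., x_n)] of rational functions, where the quotient in the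
    definition of [T_i] makes sense literally.  The Laurent polynomials
    [F[x_1^+-1, ..., x_n^+-1]] are a subring stable under all of them, see
    [laurent], [laurent_T], [laurent_Tinv] and [laurent_piop]. *)
Section Operators.

Variables (F : fieldType) (n : nat) (q t : F).

Implicit Types (f g : ratfun F n) (i j : 'I_n).

Definition cst (c : F) : ratfun F n := of_mpoly c%:MP.
Definition var i : ratfun F n := of_mpoly 'X_i.

Inductive laurent : ratfun F n -> Prop :=
| laurent_cst c : laurent (cst c)
| laurent_var i : laurent (var i)
| laurent_varV i : laurent (var i)^-1
| laurent_add f g : laurent f -> laurent g -> laurent (f + g)
| laurent_mul f g : laurent f -> laurent g -> laurent (f * g).

(** [f(lq_1, ..., lq_n)].  This is only meaningful when no nonzero polynomial
    vanishes at [lq]; it is used below for [lq_j] a nonzero multiple of a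
    permuted variable. *)
Definition rsubst (lq : n.-tuple {mpoly F[n]}) f : ratfun F n :=
  of_mpoly (\n_(generic_quotient.repr f) \mPo lq) /
  of_mpoly (\d_(generic_quotient.repr f) \mPo lq).

(** [ordS i] is the cyclic successor of [i]: [s i] and [T i] are only used for
    [i.+1 < n], the case [i.+1 = n] being junk. *)
Definition s i f : ratfun F n :=
  rsubst [tuple 'X_(tperm i (ordS i) j) | j < n] f.

Definition T i f : ratfun F n :=
  cst t * s i f + cst (t - 1) * ((f - s i f) / (1 - var i / var (ordS i))).

(** The inverse of [T i], from [(T i - t) (T i + 1) = 0]; see [TK] and
    [TinvK]. *)
Definition Tinv i f : ratfun F n := cst t^-1 * (T i f - cst (t - 1) * f).

(** [pi]: [x_j] is replaced by [x_(j+1)] for [j < n], and [x_n] by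
    [q^-1 x_1]. *)
Definition piop f : ratfun F n :=
  rsubst
    [tuple if (j.+1 < n)%N then 'X_(ordS j) else q^-1 *: 'X_(ordS j) | j < n] f.

Definition inversion (tau : 'S_n) (a b : 'I_n) : bool :=
  (a < b)%N && (tau^-1%g b < tau^-1%g a)%N.

(** [eps tau i j] is the exponent [epsilon_j] attached to [Y_i^tau]. *)
Definition eps (tau : 'S_n) i j : int :=
  if (i <= j)%N then (if inversion tau i (ordS j) then -1 else 1)
  else (if inversion tau j i then 1 else -1).

Definition epsY (tau : 'S_n) i : nat :=
  #|[set j : 'I_n | (j.+1 < n)%N && (eps tau i j == -1)]|.

Definition Teps (tau : 'S_n) i f j : ratfun F n :=
  if eps tau i j == 1 then T j f else Tinv j f.

(** [foldl] applies the operator of smallest index first, which is the rightmost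
    factor of each of the two products in [Y_i^tau]. *)
Definition Y (tau : 'S_n) i f : ratfun F n :=
  cst (t ^+ epsY tau i) *
  foldl (Teps tau i)
    (piop (foldl (Teps tau i) f
       [seq j : 'I_n <- enum 'I_n | (i <= j)%N && (j.+1 < n)%N]))
    [seq j : 'I_n <- enum 'I_n | (j < i)%N].

End Operators.
Arguments cst {F n} c.
Arguments var {F n} i.
Arguments laurent {F n} f.

Section Fillings.

Variables (n : nat) (gamma : 'I_n -> nat) (tau : 'S_n).

(** [Tagged _ j : box], with [j : 'I_(gamma i)], is the box in column [i] and
    row [j + 1]; [Tagged _ j : abox] is the box in column [i] and row [j]. *)
Definition box : finType := {i : 'I_n & 'I_(gamma i)}.
Definition abox : finType := {i : 'I_n & 'I_(gamma i).+1}.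

Definition abox_col (v : abox) : 'I_n := tag v.
Definition abox_row (v : abox) : nat := tagged v.

Definition up (u : box) : abox :=
  Tagged (fun i => 'I_(gamma i).+1) (lift ord0 (tagged u)).
Definition down (u : box) : abox :=
  Tagged (fun i => 'I_(gamma i).+1) (widen_ord (leqnSn _) (tagged u)).

Definition leg (u : box) : nat := (gamma (tag u) - abox_row (up u))%N.

Definition arm (u : box) : {set abox} :=
  [set v : abox | [&& abox_row v == abox_row (up u), (abox_col v < tag u)%N
                      & (gamma (abox_col v) <= gamma (tag u))%N]]
  :|: [set v : abox | [&& (abox_row v).+1 == abox_row (up u),
                          (tag u < abox_col v)%N
                        & (gamma (abox_col v) < gamma (tag u))%N]].

Definition attacking (u v : abox) : bool :=
  [|| (u != v) && (abox_row u == abox_row v),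
      (abox_row u == (abox_row v).+1) && (abox_col u < abox_col v)%N
    | (abox_row v == (abox_row u).+1) && (abox_col v < abox_col u)%N].

Definition filling : finType := {ffun box -> 'I_n}.

Variable sigma : filling.

Definition augment (v : abox) : 'I_n :=
  if unlift ord0 (tagged v) is Some j
  then sigma (Tagged (fun i => 'I_(gamma i)) j) else tau (tag v).

Definition nonattacking : bool :=
  [forall u : abox, forall v : abox,
     attacking u v ==> (augment u != augment v)].

Definition maj : nat :=
  (\sum_(u : box | (augment (down u) < augment (up u))%N) (leg u).+1)%N.

Definition chi (x y : abox) : int := ((augment y < augment x)%N : nat)%:Z.

Definition coinvtrip : nat :=
  #|[set uv : box * abox | (uv.2 \in arm uv.1) &&
      (chi (up uv.1) uv.2 + chi uv.2 (down uv.1)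
         - chi (up uv.1) (down uv.1) == 0)]|.

End Fillings.

Definition permuted_basement_E (F : fieldType) (q t : F) (n : nat)
    (gamma : 'I_n -> nat) (tau : 'S_n) : {mpoly F[n]} :=
  \sum_(sigma : filling gamma | nonattacking tau sigma)
    (q ^+ maj tau sigma * t ^+ coinvtrip tau sigma *
     \prod_(u : box gamma | augment tau sigma (up u)
                              != augment tau sigma (down u))
        ((1 - t) / (1 - q ^+ (leg u).+1 * t ^+ #|arm u|.+1)))
    *: \prod_(u : box gamma) 'X_(sigma u).

(** The field [Q(q, t)], with [q] and [t] its two indeterminates. *)
Definition Qqt : fieldType := ratfun rat 2.
Definition q_gen : Qqt := var ord0.
Definition t_gen : Qqt := var ord_max.

Section FieldIdentities.

Variables (K : fieldType) (x y : K).
Hypotheses (x0 : x != 0) (y0 : y != 0) (xy : x != y).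

Let nz : (y - x != 0) /\ (x - y != 0).
Proof. by rewrite !subr_eq0 eq_sym xy. Qed.

Lemma hecke_quadratic (u f g : K) :
  u * (u * f + (u - 1) * ((g - f) / (1 - y / x))) +
  (u - 1) *
  ((u * g + (u - 1) * ((f - g) / (1 - x / y)) -
    (u * f + (u - 1) * ((g - f) / (1 - y / x)))) / (1 - x / y)) =
  (u - 1) * (u * g + (u - 1) * ((f - g) / (1 - x / y))) + u * f.
Proof.
by have [? ?] := nz; field; rewrite ?x0 ?y0; do ?[apply/andP; split].
Qed.

Lemma divdiff_var : (x - y) / (1 - x / y) = - y.
Proof.
by have [? ?] := nz; field; rewrite ?x0 ?y0; do ?[apply/andP; split].
Qed.

Lemma divdiff_varS : (y - x) / (1 - x / y) = y.
Proof.
by have [? ?] := nz; field; rewrite ?x0 ?y0; do ?[apply/andP; split].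
Qed.

Lemma divdiff_varV : (x^-1 - y^-1) / (1 - x / y) = x^-1.
Proof.
by have [? ?] := nz; field; rewrite ?x0 ?y0; do ?[apply/andP; split].
Qed.

Lemma divdiff_varSV : (y^-1 - x^-1) / (1 - x / y) = - x^-1.
Proof.
by have [? ?] := nz; field; rewrite ?x0 ?y0; do ?[apply/andP; split].
Qed.

Lemma divdiffM (f f' g g' z : K) :
  (f * g - f' * g') * z = (f - f') * z * g + f' * ((g - g') * z).
Proof. by ring. Qed.

Lemma T_lin_subproof (u v c f f' g g' z : K) :
  u * (c * (f' - g')) + v * ((c * (f - g) - c * (f' - g')) * z) =
  c * (u * f' + v * ((f - f') * z) - (u * g' + v * ((g - g') * z))).
Proof. by ring. Qed.

End FieldIdentities.

(** The definitions above behave as expected: [s] and [piop] are the field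
    morphisms given on variables by [s_var] and [piop_var], [Tinv] is the
    inverse of [T], and Laurent polynomials are preserved. *)
Section OperatorFacts.

Lemma fracE (R : idomainType) (x : {fraction R}) :
  x = (\n_(generic_quotient.repr x))%:F / (\d_(generic_quotient.repr x))%:F.
Proof.
have d0 := denom_ratioP (generic_quotient.repr x).
apply: (canRL (mulfK _)); first by rewrite tofrac_eq0.
rewrite -[in LHS](generic_quotient.reprK x).
unlock FracField.tofrac; rewrite -[LHS]FracField.pi_mul.
apply/generic_quotient.eqmodP => /=.
rewrite FracField.equivfE /FracField.mulf !numden_Ratio ?oner_neq0 ?mulr1 //.
by rewrite generic_quotient.reprK mulrC.
Qed.

Variables (F : fieldType) (n : nat) (q t : F).
Hypotheses (q_neq0 : q != 0) (t_neq0 : t != 0).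

Implicit Types (f g : ratfun F n) (i j : 'I_n) (lq : n.-tuple {mpoly F[n]}).

Fact of_mpoly_is_zmod_morphism : zmod_morphism (@of_mpoly F n).
Proof. by move=> a b; rewrite /of_mpoly tofracB. Qed.
Fact of_mpoly_is_monoid_morphism : monoid_morphism (@of_mpoly F n).
Proof. by split=> [|a b]; rewrite /of_mpoly ?tofrac1 ?rmorphM. Qed.
HB.instance Definition _ := GRing.isZmodMorphism.Build {mpoly F[n]} (ratfun F n)
  (@of_mpoly F n) of_mpoly_is_zmod_morphism.
HB.instance Definition _ := GRing.isMonoidMorphism.Build {mpoly F[n]}
  (ratfun F n) (@of_mpoly F n) of_mpoly_is_monoid_morphism.

Lemma of_mpoly_inj : injective (@of_mpoly F n).
Proof. by move=> a b /eqP; rewrite /of_mpoly tofrac_eq => /eqP. Qed.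

Lemma of_mpoly_eq0 (p : {mpoly F[n]}) : (of_mpoly p == 0) = (p == 0).
Proof. by rewrite -(rmorph0 (@of_mpoly F n)) (inj_eq of_mpoly_inj). Qed.

Lemma ratfunE f :
  f = of_mpoly (\n_(generic_quotient.repr f)) /
      of_mpoly (\d_(generic_quotient.repr f)).
Proof. exact: fracE. Qed.

Lemma ratfunP f : exists a b : {mpoly F[n]},
  b != 0 /\ f = of_mpoly a / of_mpoly b.
Proof.
exists (\n_(generic_quotient.repr f)), (\d_(generic_quotient.repr f)).
by split; [exact: denom_ratioP | exact: ratfunE].
Qed.

Fact cst_is_zmod_morphism : zmod_morphism (@cst F n).
Proof. by move=> a b; rewrite /cst !rmorphB. Qed.
Fact cst_is_monoid_morphism : monoid_morphism (@cst F n).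
Proof. by split=> [|a b]; rewrite /cst ?rmorph1 ?rmorphM. Qed.
HB.instance Definition _ :=
  GRing.isZmodMorphism.Build F (ratfun F n) (@cst F n) cst_is_zmod_morphism.
HB.instance Definition _ :=
  GRing.isMonoidMorphism.Build F (ratfun F n) (@cst F n) cst_is_monoid_morphism.

Lemma var_neq0 i : var i != 0 :> ratfun F n.
Proof.
rewrite /var of_mpoly_eq0; apply/eqP=> /mpolyP/(_ U_(i)%MM)/eqP.
by rewrite mcoeffX eqxx mcoeff0 oner_eq0.
Qed.

Lemma var_inj : injective (@var F n).
Proof.
move=> i j /of_mpoly_inj/mpolyP/(_ U_(i)%MM).
rewrite !mcoeffX eqxx; have [e _|_ /eqP] := eqVneq; last by rewrite oner_eq0.
by move/mnmP: e => /(_ i); rewrite !mnm1E eqxx; case: (eqVneq j i).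
Qed.

Definition nonvanishing lq := forall p, p \mPo lq = 0 -> p = 0.

Section Subst.
Variables (lq : n.-tuple {mpoly F[n]}) (lq0 : nonvanishing lq).

Lemma rsubst_frac (a b : {mpoly F[n]}) : b != 0 ->
  rsubst lq (of_mpoly a / of_mpoly b) =
  of_mpoly (a \mPo lq) / of_mpoly (b \mPo lq).
Proof.
move=> b0; set f : ratfun F n := of_mpoly a / of_mpoly b.
have := ratfunE f; have := denom_ratioP (generic_quotient.repr f).
rewrite {2}/f /rsubst.
move: (\n_(generic_quotient.repr f)) (\d_(generic_quotient.repr f)) => x y y0.
move=> /eqP.
have sn0 p : p != 0 -> of_mpoly (p \mPo lq) != 0 :> ratfun F n.
  by rewrite of_mpoly_eq0; apply: contra_neq => /lq0.
rewrite eqr_div ?of_mpoly_eq0 // -!rmorphM (inj_eq of_mpoly_inj) => /eqP e.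
by apply/eqP; rewrite eqr_div ?sn0 // -!rmorphM /= e.
Qed.

Lemma rsubstF (a : {mpoly F[n]}) : rsubst lq (of_mpoly a) = of_mpoly (a \mPo lq).
Proof.
have := rsubst_frac a (oner_neq0 _).
by rewrite rmorph1 !rmorph1 !divr1.
Qed.

Fact rsubst_is_zmod_morphism : zmod_morphism (rsubst lq).
Proof.
move=> f g; have [a [b [b0 ->]]] := ratfunP f; have [c [d [d0 ->]]] := ratfunP g.
have sn0 p : p != 0 -> of_mpoly (p \mPo lq) != 0 :> ratfun F n.
  by rewrite of_mpoly_eq0; apply: contra_neq => /lq0.
rewrite -mulNr addf_div ?of_mpoly_eq0 // -rmorphN -!rmorphM -rmorphD /=.
rewrite !rsubst_frac ?mulf_neq0 // !(rmorphD, rmorphM, rmorphN) /= -mulNr.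
by rewrite addf_div ?sn0.
Qed.
Fact rsubst_is_monoid_morphism : monoid_morphism (rsubst lq).
Proof.
split=> [|f g]; first by rewrite -(rmorph1 (@of_mpoly F n)) rsubstF !rmorph1.
have [a [b [b0 ->]]] := ratfunP f; have [c [d [d0 ->]]] := ratfunP g.
rewrite mulf_div -!rmorphM !rsubst_frac ?mulf_neq0 //.
by rewrite mulf_div -!rmorphM.
Qed.
End Subst.

Lemma comp_mpoly_comp lq1 lq2 p :
  (p \mPo lq1) \mPo lq2 = p \mPo [tuple tnth lq1 j \mPo lq2 | j < n].
Proof.
rewrite (comp_mpolyEX p lq1) (comp_mpolyEX p) raddf_sum /=.
apply: eq_bigr => m _.
rewrite linearZ /= !comp_mpolyX rmorph_prod /=; congr (_ *: _).
by apply: eq_bigr => j _; rewrite rmorphXn /= tnth_mktuple.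
Qed.

Lemma nonvanishingP lq1 lq2 :
  (forall j, tnth lq1 j \mPo lq2 = 'X_j) -> nonvanishing lq1.
Proof.
move=> K p p0; rewrite -(comp_mpoly_id p).
rewrite (_ : [tuple _ | _ < _] = [tuple tnth lq1 j \mPo lq2 | j < n]).
  by rewrite -comp_mpoly_comp p0 rmorph0.
by apply: eq_from_tnth => j; rewrite !tnth_mktuple K.
Qed.

Lemma s_nonvanishing i :
  nonvanishing [tuple 'X_(tperm i (ordS i) j) | j < n].
Proof.
apply: (nonvanishingP (lq2 := [tuple 'X_(tperm i (ordS i) j) | j < n])) => j.
by rewrite tnth_mktuple comp_mpolyXU -tnth_nth tnth_mktuple tpermK.
Qed.

Lemma piop_nonvanishing :
  nonvanishing
    [tuple if (j.+1 < n)%N then 'X_(ordS j) else q^-1 *: 'X_(ordS j) | j < n].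
Proof.
pose lq2 := [tuple if ((ord_pred j).+1 < n)%N then 'X_(ord_pred j)
                   else q *: 'X_(ord_pred j) | j < n] : n.-tuple {mpoly F[n]}.
apply: (nonvanishingP (lq2 := lq2)) => j; rewrite tnth_mktuple.
have E : 'X_(ordS j) \mPo lq2 = if (j.+1 < n)%N then 'X_j else q *: 'X_j.
  by rewrite comp_mpolyXU -tnth_nth tnth_mktuple ordSK.
by case: ifP E => _ E; rewrite ?linearZ /= E // scalerA mulVf ?scale1r.
Qed.

HB.instance Definition _ i := GRing.isZmodMorphism.Build _ _ (@s F n i)
  (rsubst_is_zmod_morphism (s_nonvanishing (i := i))).
HB.instance Definition _ i := GRing.isMonoidMorphism.Build _ _ (@s F n i)
  (rsubst_is_monoid_morphism (s_nonvanishing (i := i))).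

Lemma s_cst i (c : F) : s i (cst c) = cst c :> ratfun F n.
Proof. by rewrite /s /cst rsubstF ?comp_mpolyC //; apply: s_nonvanishing. Qed.

Lemma s_var i j : s i (var j) = var (tperm i (ordS i) j) :> ratfun F n.
Proof.
rewrite /s /var rsubstF; last exact: s_nonvanishing.
by rewrite comp_mpolyXU -tnth_nth tnth_mktuple.
Qed.

Lemma sK i : involutive (@s F n i).
Proof.
move=> f; have [a [b [b0 ->]]] := ratfunP f.
suff K p : s i (s i (of_mpoly p)) = (of_mpoly p) :> ratfun F n.
  pose r : {rmorphism ratfun F n -> ratfun F n} := @s F n i.
  have {}K p : r (r (of_mpoly p)) = (of_mpoly p) by exact: K.
  rewrite -[LHS]/(r (r (of_mpoly a / of_mpoly b))); move: r K => r K.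
  by rewrite !rmorphM !fmorphV !K.
rewrite /s !rsubstF; try exact: s_nonvanishing.
rewrite comp_mpoly_comp; congr of_mpoly; rewrite -[RHS]comp_mpoly_id.
congr (_ \mPo _); apply: eq_from_tnth => j.
by rewrite !tnth_mktuple comp_mpolyXU -tnth_nth tnth_mktuple tpermK.
Qed.

Lemma piop_cst (c : F) : piop q (cst c) = cst c :> ratfun F n.
Proof.
by rewrite /piop /cst rsubstF ?comp_mpolyC //; apply: piop_nonvanishing.
Qed.

Lemma piop_var j : piop q (var j) =
  (if (j.+1 < n)%N then 1 else cst q^-1) * var (ordS j) :> ratfun F n.
Proof.
rewrite /piop /var rsubstF; last exact: piop_nonvanishing.
rewrite comp_mpolyXU -tnth_nth tnth_mktuple; case: ifP; rewrite ?mul1r //.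
by rewrite -mul_mpolyC rmorphM.
Qed.

Lemma var_ordS i : (i.+1 < n)%N -> var i != var (ordS i) :> ratfun F n.
Proof.
move=> i_lt; apply/eqP => /var_inj/(congr1 val)/=.
by rewrite modn_small // => /eqP; rewrite -[X in X == _]addn0 -addn1 eqn_add2l.
Qed.

Lemma T_quadratic i f : (i.+1 < n)%N ->
  T t i (T t i f) = cst (t - 1) * T t i f + cst t * f.
Proof.
move=> /var_ordS.
have := var_neq0 i; have := var_neq0 (ordS i).
pose r : {rmorphism ratfun F n -> ratfun F n} := @s F n i.
have rx : r (var i) = var (ordS i) by rewrite /= s_var tpermL.
have ry : r (var (ordS i)) = var i by rewrite /= s_var tpermR.
have rc c : r (cst c) = cst c by apply: s_cst.
have rK : involutive r by apply: sK.
have E g : T t i g = cst t * r g +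
    cst (t - 1) * ((g - r g) / (1 - var i / var (ordS i))) by [].
rewrite !{}E; move: r rx ry rc rK.
move: (var i) (var (ordS i)) => x y r rx ry rc rK y0 x0 xy.
rewrite !(rmorphB, rmorphD, rmorphM, fmorphV, rmorph1) /= !rc rx ry rK.
exact: (hecke_quadratic x0 y0 xy (cst t) f (r f)).
Qed.

Lemma cst_tV : cst t * cst t^-1 = 1 :> ratfun F n.
Proof. by rewrite -rmorphM mulfV ?rmorph1. Qed.

Lemma T_lin i (c : F) f g :
  T t i (cst c * (f - g)) = cst c * (T t i f - T t i g).
Proof.
have E h : T t i h = cst t * s i h +
    cst (t - 1) * ((h - s i h) / (1 - var i / var (ordS i))) by [].
rewrite !{}E rmorphM rmorphB /= s_cst.
exact: T_lin_subproof.
Qed.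

Lemma T_cstM i (c : F) f : T t i (cst c * f) = cst c * T t i f.
Proof.
have T0 : T t i 0 = 0 :> ratfun F n.
  have E h : T t i h = cst t * s i h +
    cst (t - 1) * ((h - s i h) / (1 - var i / var (ordS i))) by [].
  by rewrite E rmorph0 subr0 mul0r !mulr0 addr0.
by have := T_lin i c f 0; rewrite T0 !subr0.
Qed.

Lemma TK i : (i.+1 < n)%N -> cancel (@T F n t i) (@Tinv F n t i).
Proof.
move=> i_lt f; rewrite /Tinv T_quadratic // addrAC subrr add0r mulrA.
by rewrite [cst _ * cst _]mulrC cst_tV mul1r.
Qed.

Lemma TinvK i : (i.+1 < n)%N -> cancel (@Tinv F n t i) (@T F n t i).
Proof.
by move=> i_lt f; rewrite /Tinv T_lin T_cstM; exact: TK.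
Qed.

Lemma laurent_N f : laurent f -> laurent (- f).
Proof.
by move=> lf; rewrite -mulN1r -(rmorphN1 (@cst F n)); apply: laurent_mul => //;
   apply: laurent_cst.
Qed.

Lemma laurent_s i f : laurent f -> laurent (s i f).
Proof.
elim=> [c|j|j|g h _ lg _ lh|g h _ lg _ lh].
- by rewrite s_cst; apply: laurent_cst.
- by rewrite s_var; apply: laurent_var.
- by rewrite fmorphV /= s_var; apply: laurent_varV.
- by rewrite rmorphD; apply: laurent_add.
- by rewrite rmorphM; apply: laurent_mul.
Qed.

Lemma laurent_divdiff i f : (i.+1 < n)%N -> laurent f ->
  laurent ((f - s i f) / (1 - var i / var (ordS i))).
Proof.
move=> /var_ordS xy; have x0 := @var_neq0 i; have y0 := @var_neq0 (ordS i).
have L0 : laurent (0 : ratfun F n) by rewrite -(rmorph0 (@cst F n)); constructor.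
elim=> [c|j|j|g h lg Dg lh Dh|g h lg Dg lh Dh].
- by rewrite s_cst subrr mul0r.
- rewrite s_var; case: tpermP => [->|->|_ _]; last by rewrite subrr mul0r.
  + by rewrite divdiff_var //; apply/laurent_N/laurent_var.
  + by rewrite divdiff_varS //; apply/laurent_var.
- rewrite fmorphV /= s_var; case: tpermP => [->|->|_ _].
  + by rewrite divdiff_varV //; apply/laurent_varV.
  + by rewrite divdiff_varSV //; apply/laurent_N/laurent_varV.
  + by rewrite subrr mul0r.
- by rewrite rmorphD /= opprD addrACA mulrDl; apply: laurent_add.
- rewrite rmorphM /= divdiffM.
  by apply: laurent_add; apply: laurent_mul => //; apply: laurent_s.
Qed.

Lemma laurent_T i f : (i.+1 < n)%N -> laurent f -> laurent (T t i f).
Proof.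
move=> i_lt lf; apply: laurent_add; apply: laurent_mul; try exact: laurent_cst.
  exact: laurent_s.
exact: laurent_divdiff.
Qed.

Lemma laurent_Tinv i f : (i.+1 < n)%N -> laurent f -> laurent (Tinv t i f).
Proof.
move=> i_lt lf; apply: laurent_mul; first exact: laurent_cst.
apply: laurent_add; first exact: laurent_T.
by apply/laurent_N/laurent_mul => //; apply: laurent_cst.
Qed.

Lemma laurent_piop f : laurent f -> laurent (piop q f).
Proof.
have pM := rsubst_is_monoid_morphism piop_nonvanishing.
have pB := rsubst_is_zmod_morphism piop_nonvanishing.
pose B1 := GRing.isZmodMorphism.Build _ _ _ pB.
pose B2 := GRing.isMonoidMorphism.Build _ _ _ pM.
pose r : {rmorphism ratfun F n -> ratfun F n} :=
  HB.pack (@piop F n q) B1 B2.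
have L1 : laurent (1 : ratfun F n) by rewrite -(rmorph1 (@cst F n)); constructor.
have rc c : r (cst c) = cst c by apply: piop_cst.
have rv j : r (var j) = (if (j.+1 < n)%N then 1 else cst q^-1) * var (ordS j).
  exact: piop_var.
rewrite -[piop q]/(r : _ -> _); move: r rc rv => r rc rv.
elim=> [c|j|j|g h _ lg _ lh|g h _ lg _ lh].
- by rewrite rc; apply: laurent_cst.
- rewrite rv; apply: laurent_mul; last exact: laurent_var.
  by case: ifP => // _; apply: laurent_cst.
- rewrite fmorphV rv invfM; apply: laurent_mul; last exact: laurent_varV.
  by case: ifP => _; rewrite ?invr1 // -fmorphV; apply: laurent_cst.
- by rewrite rmorphD; apply: laurent_add.
- by rewrite rmorphM; apply: laurent_mul.
Qed.

Lemma laurent_of_mpoly (p : {mpoly F[n]}) : laurent (of_mpoly p).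
Proof.
elim/mpolyind: p => [|c m p _ _ lp].
  by rewrite -(rmorph0 (@mpolyC n F)); apply: laurent_cst.
rewrite rmorphD; apply: laurent_add => //.
rewrite -mul_mpolyC rmorphM; apply: laurent_mul; first exact: laurent_cst.
rewrite mpolyXE_id rmorph_prod /=.
apply: (big_ind (@laurent F n)) => [|f g|j _]; last 1 first.
- elim: (m j) => [|k IH].
    by rewrite expr0 rmorph1 -(rmorph1 (@cst F n)); constructor.
  by rewrite exprS rmorphM; apply: laurent_mul => //; apply: laurent_var.
- by rewrite -(rmorph1 (@cst F n)); constructor.
- exact: laurent_mul.
Qed.

End OperatorFacts.

Lemma q_gen_neq0 : q_gen != 0. Proof. exact: var_neq0. Qed.
Lemma t_gen_neq0 : t_gen != 0. Proof. exact: var_neq0. Qed.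

(* Main.v *)
From HB Require Import structures.
Require Import Defs.
From mathcomp Require Import all_boot all_order all_fingroup all_algebra.
From mathcomp Require Import zify ring.

(** The operators of which [Y_i^tau] is the product permute the basement.
    First, [pi E_tau = q^(-gamma_p) E_(c tau)], where [c] is the cyclic shift of
    the entries and [tau(p) = n]: shifting all entries of a filling preserves
    coinversion triples and changes [maj] by a telescoping sum in each column.
    Second, if [k] is to the left of [k+1] in [tau], then [T_k E_tau] is a
    nonzero multiple of [E_(s_k tau)].  The exponents [eps_j] are such that
    each factor of [Y_i^tau] applies one of these two facts (or its inverse),
    and the basement finally returns to [tau].

    For the second fact, number the boxes by [pos = n * row + column]:
    attacking boxes are those at distance less than [n], and [d(u)] is at
    distance [n] from [u].  Counting inversions along pairs of attacking boxes,
    the weight of a filling becomes, up to a constant, a product over pairs of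
    boxes.  Fix the entries other than [k], [k+1] and the set of boxes that
    contain these two.  Attacking boxes having different entries, at most two of
    these boxes lie in any window of length [n], so that the sum over their
    colourings by [k], [k+1] is computed by a chain of 2x2 transfer matrices.
    Starting from the top, the sums with prescribed colour of the last box are
    [B + y A] and [B + t x A] with [x = x_k], [y = x_(k+1)] and [A], [B]
    symmetric in [x], [y]; and
    [T_k (B + t x A) = t (B + y A)]. *)

Set Implicit Arguments.
Unset Strict Implicit.
Unset Printing Implicit Defensive.

Import GRing.Theory.
Local Open Scope ring_scope.

(** * Adjacent transpositions and the cyclic shift of the entries *)

Section CyclicSuccessor.

Variable n : nat.
Implicit Types (c d k : 'I_n).

Lemma val_ordS_lt k : (k.+1 < n)%N -> ordS k = k.+1 :> nat.
Proof. by move=> k_lt; rewrite /= modn_small. Qed.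

Lemma ordS_neq k : (k.+1 < n)%N -> ordS k != k.
Proof. by move=> k_lt; apply/eqP => e; have := val_ordS_lt k_lt; rewrite e => /n_Sn. Qed.

Lemma tperm_val k (w : 'I_n) : (k.+1 < n)%N ->
  tperm k (ordS k) w =
  (if w == k :> nat then k.+1 else if w == k.+1 :> nat then k : nat else w)
  :> nat.
Proof.
move=> k_lt; have ek := val_ordS_lt k_lt; case: tpermP => [->|->|].
- by rewrite eqxx ek.
- by rewrite ek eqxx gtn_eqF.
move=> /eqP + /eqP; rewrite -!(inj_eq val_inj) -[val (ordS k)]/(nat_of_ord _) ek.
by move=> /negPf /= -> /negPf ->.
Qed.

Lemma ordS_inj : injective (@ordS n).
Proof. exact: can_inj (@ordSK n). Qed.

Definition rot_perm : 'S_n := perm ordS_inj.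

Lemma val_ordS c : ordS c = (if c.+1 == n then 0 else c.+1)%N :> nat.
Proof.
rewrite /=; case: eqP => [->|ne]; first by rewrite modnn.
by rewrite modn_small //; have := ltn_ord c; lia.
Qed.

(** Only comparisons with the last entry, which wraps to 0, are disturbed. The indicator of [d < c]
    thus changes by a difference of one function at [d] and at [c], which cancels in triples and
    telescopes in columns. *)
Lemma ltn_ordS c d :
  ((ordS d < ordS c) + (c.+1 == n) = (d < c) + (d.+1 == n))%N.
Proof.
rewrite !val_ordS; have := ltn_ord c; have := ltn_ord d.
by case: eqP => ec; case: eqP => ed; lia.
Qed.

End CyclicSuccessor.

(** * Interval enumerations, folds and summation by parts *)

Lemma enum_interval (n m d : nat) (P : pred 'I_n) :
  (m + d <= n)%N -> (forall j, P j = (m <= j < m + d)%N) ->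
  map val [seq j <- enum 'I_n | P j] = iota m d.
Proof.
move=> md Pj; have {}Pj : P =1 preim val (fun j : nat => m <= j < m + d)%N by [].
rewrite (eq_filter Pj) -filter_map val_enum_ord.
apply: (irr_sorted_eq ltn_trans ltnn).
- exact/(sorted_filter ltn_trans)/iota_ltn_sorted.
- exact: iota_ltn_sorted.
- by move=> j; rewrite mem_filter !mem_iota; lia.
Qed.

(** A loop invariant for the products of operators in [Y]: [P j] is what holds just before the
    operator of index [j] acts. *)
Lemma foldl_iota n (A : Type) (P : nat -> A -> Prop) (op : A -> 'I_n -> A) l m f :
  map val l = iota m (size l) -> P m f ->
  (forall (j : 'I_n) g, j \in l -> P j g -> P j.+1 (op g j)) ->
  P (m + size l)%N (foldl op f l).
Proof.
elim: l m f => [|j l IH] m f /=; first by rewrite addn0.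
case=> <- el Pf step; rewrite addnS -addSn; apply: IH => //.
  by apply: step; rewrite ?mem_head.
by move=> j' g jl; apply: step; rewrite inE jl orbT.
Qed.

(** Summation by parts in a column of height [m]: [m - j] is one more than the leg of the box above
    row [j], and [b j] will mark an entry [n] in row [j]. *)
Lemma sum_legs (b : nat -> nat) m :
  (\sum_(j < m) (m - j) * b j + \sum_(j < m) b j.+1 =
   m * b 0 + \sum_(j < m) (m - j) * b j.+1)%N.
Proof.
elim: m => [|m IH]; first by rewrite !big_ord0.
have step (c : nat -> nat) : (\sum_(j < m.+1) (m.+1 - j) * c j =
    \sum_(j < m) (m - j) * c j + \sum_(j < m.+1) c j)%N.
  rewrite big_ord_recr [in RHS]big_ord_recr /= addnA -big_split /= subSnn mul1n.
  by congr (_ + _)%N; apply: eq_bigr => j _; rewrite subSn ?mulSn 1?addnC // ltnW.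
rewrite (step b) (step (fun j => b j.+1)) [X in (_ + X + _)%N]big_ord_recl /=.
under [X in (_ + (_ + X) + _)%N]eq_bigr do rewrite /bump /= add1n.
rewrite [(b 0 + _)%N]addnC addnA IH mulSn.
by rewrite -!addnA [(_ + (b 0 + _))%N]addnCA [(_ + (b 0 + _))%N]addnCA.
Qed.

(** * Attacking pairs and arms in terms of positions *)

Section Positions.

Variables (n : nat) (gamma : 'I_n -> nat).
Local Notation abox := (abox gamma).
Local Notation box := (box gamma).
Implicit Types (v w p : abox) (u : box).

Definition pos v : nat := (abox_row v * n + abox_col v)%N.

Lemma abox_eq v w : abox_row v = abox_row w -> abox_col v = abox_col w -> v = w.
Proof.
case: v w => [i j] [i' j']; rewrite /abox_row /abox_col /= => ejj eii.
by case: _ / eii j' ejj => j' /val_inj ->.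
Qed.

Lemma row_le v : (abox_row v <= gamma (abox_col v))%N.
Proof. by rewrite -ltnS; apply: ltn_ord. Qed.

Lemma pos_lt v w : (pos v < pos w)%N =
  (abox_row v < abox_row w)%N ||
  (abox_row v == abox_row w) && (abox_col v < abox_col w)%N.
Proof.
rewrite /pos; have := ltn_ord (abox_col v); have := ltn_ord (abox_col w).
move: (abox_row v) (abox_row w) => r s.
move: (nat_of_ord (abox_col v)) (nat_of_ord (abox_col w)) => c d dn cn.
have [lt|lt|<-] /= := ltngtP r s; nia.
Qed.

Lemma pos_lt_near v w : (pos w < pos v + n)%N =
  (abox_row w <= abox_row v)%N ||
  (abox_row w == (abox_row v).+1) && (abox_col w < abox_col v)%N.
Proof.
rewrite /pos; have := ltn_ord (abox_col v); have := ltn_ord (abox_col w).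
move: (abox_row v) (abox_row w) => r s.
move: (nat_of_ord (abox_col v)) (nat_of_ord (abox_col w)) => c d dn cn.
have [lt|lt] /= := leqP s r; first by nia.
have [->|ne] /= := eqVneq s r.+1; nia.
Qed.

Lemma pos_above v w : (pos w == pos v + n)%N =
  (abox_row w == (abox_row v).+1) && (abox_col w == abox_col v).
Proof.
rewrite -(inj_eq val_inj) /pos /=.
have := ltn_ord (abox_col v); have := ltn_ord (abox_col w).
move: (abox_row v) (abox_row w) => r s.
move: (nat_of_ord (abox_col v)) (nat_of_ord (abox_col w)) => c d dn cn.
have [lt|lt|->] /= := ltngtP s r.+1; nia.
Qed.

Lemma pos_inj : injective pos.
Proof.
move=> v w e; have := pos_lt v w; have := pos_lt w v; rewrite e ltnn.
have [lt|lt|er] //= := ltngtP (abox_row v) (abox_row w).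
have [lt|lt|/val_inj ec _ _] //= := ltngtP (abox_col v) (abox_col w).
exact: abox_eq.
Qed.

Definition near v w := (pos v < pos w < pos v + n)%N.
Definition above v w := (pos w == pos v + n)%N.

Lemma attackingE v w : attacking v w = near v w || near w v.
Proof.
rewrite /attacking /near !pos_lt !pos_lt_near -(inj_eq pos_inj) neq_ltn !pos_lt.
move: (abox_row v) (abox_row w) => r s.
move: (nat_of_ord (abox_col v)) (nat_of_ord (abox_col w)) => c d.
lia.
Qed.

Lemma above_down_up u : above (down u) (up u).
Proof. by rewrite /above pos_above /abox_row /abox_col /= eqxx andbT. Qed.

Lemma aboveP v w : reflect (exists u, v = down u /\ w = up u) (above v w).
Proof.
apply: (iffP idP) => [|[u [-> ->]]]; last exact: above_down_up.
rewrite /above pos_above => /andP[/eqP er /eqP ec].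
have lt : (abox_row v < gamma (abox_col v))%N.
  by rewrite -ec -er; apply: row_le.
exists (Tagged (fun i => 'I_(gamma i)) (Ordinal lt)); split; apply: abox_eq => //.
Qed.

Lemma up_inj : injective (@up n gamma).
Proof.
move=> [i j] [i' j'] e; have ei : i = i' by case: e.
case: _ / ei j' e => j' e; congr (Tagged _ _); apply: val_inj.
by have := congr1 (@abox_row n gamma) e; case.
Qed.

(** The arm compares heights by [<=] on the left and by [<] on the right; both are this single order
    on columns, with ties broken from left to right. *)
Definition shorter v w :=
  (gamma (abox_col v) < gamma (abox_col w))%N ||
  (gamma (abox_col v) == gamma (abox_col w)) && (abox_col v < abox_col w)%N.

Lemma shorterN v w : abox_col v != abox_col w -> shorter w v = ~~ shorter v w.
Proof.
rewrite -(inj_eq val_inj) /shorter /=.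
move: (gamma (abox_col v)) (gamma (abox_col w)) => g h.
move: (nat_of_ord (abox_col v)) (nat_of_ord (abox_col w)) => c d.
lia.
Qed.

Lemma near_col v w : near v w -> abox_col v != abox_col w.
Proof.
rewrite -(inj_eq val_inj) /near pos_lt pos_lt_near /=; lia.
Qed.

Lemma mem_arm u v :
  (v \in arm u) = [&& (pos (down u) < pos v)%N, (pos v < pos (up u))%N
                    & shorter v (up u)].
Proof.
have /eqP e := above_down_up u.
rewrite !inE !pos_lt /shorter {e}.
rewrite [abox_col (up u)]/(tag u) [abox_col (down u)]/(tag u).
have -> : abox_row (up u) = (abox_row (down u)).+1 by [].
move: (abox_row (down u)) (abox_row v) => r s.
move: (gamma (abox_col v)) (gamma (tag u)) => g h.
move: (nat_of_ord (abox_col v)) (nat_of_ord (tag u)) => c d.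
lia.
Qed.

Lemma arm_near_up u v : (v \in arm u) = near v (up u) && shorter v (up u).
Proof.
have /eqP e := above_down_up u.
by rewrite mem_arm /near e ltn_add2r andbA [(_ < pos v)%N && _]andbC.
Qed.

Lemma arm_near_down u v : (v \in arm u) = near (down u) v && shorter v (down u).
Proof.
by have /eqP e := above_down_up u; rewrite mem_arm /near e andbA.
Qed.

(** The box [w] lies further right in the row of [v], or in the next row, so its column is no
    shorter. Hence a near pair with [shorter w v] always has a box above [v]. *)
Lemma top_not_shorter v w : abox_row v = gamma (abox_col v) -> near v w ->
  ~~ shorter w v.
Proof.
move=> top; rewrite /near pos_lt /shorter => /andP[lt _]; have := row_le w.
rewrite -top; move: lt; move: (abox_row v) (abox_row w) (gamma _) => r s g.
move: (nat_of_ord (abox_col v)) (nat_of_ord (abox_col w)) => c d.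
lia.
Qed.

Lemma row_gt0P w : reflect (exists u, w = up u) (0 < abox_row w)%N.
Proof.
apply: (iffP idP) => [w0|[u ->]] //.
have lt : ((abox_row w).-1 < gamma (abox_col w))%N.
  by rewrite prednK //; apply: row_le.
exists (Tagged (fun i => 'I_(gamma i)) (Ordinal lt)).
by apply: abox_eq => //; rewrite /abox_row /= /bump /= add1n prednK.
Qed.

Lemma down_inj : injective (@down n gamma).
Proof.
move=> u u' e; apply/up_inj/pos_inj.
by have /eqP -> := above_down_up u; have /eqP -> := above_down_up u'; rewrite e.
Qed.

Lemma not_topP w : reflect (exists u, w = down u) (abox_row w < gamma (abox_col w))%N.
Proof.
apply: (iffP idP) => [lt|[u ->]]; last by apply: (ltn_ord (tagged u)).
exists (Tagged (fun i => 'I_(gamma i)) (Ordinal lt)); exact: abox_eq.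
Qed.

End Positions.

(** * Weights as products over pairs of boxes *)

Section PairWeights.

Variables (F : fieldType) (n : nat) (q t : F) (gamma : 'I_n -> nat).
Local Notation abox := (abox gamma).
Local Notation box := (box gamma).
Implicit Types (v w : abox) (u : box) (c d : 'I_n).

(* For [w = up u] this is [q ^ (l(u) + 1) * t ^ a(u)]. *)
Definition hook w : F :=
  q ^+ (gamma (abox_col w) - abox_row w).+1 *
  t ^+ #|[set v | near v w && shorter v w]|.

Definition att c d : F := if c == d then 0 else if (c < d)%N then t^-1 else 1.

(** With [Q] equal to [q^(l(u)+1) t^a(u)], an ascent from [d(u)] to [u] contributes [q^(l(u)+1)]
    through [maj] and one [t] for each of the [a(u)] triples at [u]. *)
Definition vert (Q : F) c d : F :=
  if c == d then 1 else (1 - t) / (1 - Q * t) * (if (c < d)%N then Q else 1).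

Definition pair_weight v w c d : F :=
  if near v w then att c d else if above v w then vert (hook w) c d else 1.

Definition weight (f : abox -> 'I_n) : F :=
  \prod_v \prod_(w | (pos v < pos w)%N) pair_weight v w (f v) (f w).

Lemma prod_above (G : abox -> abox -> F) :
  \prod_v \prod_(w | above v w) G v w = \prod_u G (down u) (up u).
Proof.
rewrite pair_big_dep /=.
pose h u := (down u, up u).
rewrite (eq_bigl (mem (h @: setT))) => [|[v w]] /=.
  rewrite big_imset /= => [|u u' _ _ /(congr1 snd)/up_inj //].
  by apply: eq_bigl => u; rewrite inE.
apply/aboveP/imsetP => [[u [-> ->]]|[u _ [-> ->]]]; last by exists u.
by exists u.
Qed.

Lemma prod_up (G : abox -> F) :
  \prod_(w | (0 < abox_row w)%N) G w = \prod_u G (up u).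
Proof.
rewrite (eq_bigl (mem ((@up n gamma) @: setT))) => [|w] /=.
  rewrite big_imset /= => [|u u' _ _ /up_inj //].
  by apply: eq_bigl => u; rewrite inE.
by apply/row_gt0P/imsetP => [[u ->]|[u _ ->]]; exists u.
Qed.

Lemma prod_down (G : abox -> F) :
  \prod_(w | (abox_row w < gamma (abox_col w))%N) G w = \prod_u G (down u).
Proof.
rewrite (eq_bigl (mem ((@down n gamma) @: setT))) => [|w] /=.
  rewrite big_imset /= => [|u u' _ _ /down_inj //].
  by apply: eq_bigl => u; rewrite inE.
by apply/not_topP/imsetP => [[u ->]|[u _ ->]]; exists u.
Qed.

Lemma prod_arm_up (G : abox -> abox -> F) :
  \prod_u \prod_(v in arm u) G v (up u) =
  \prod_v \prod_(w | near v w)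
     (if shorter v w && (0 < abox_row w)%N then G v w else 1).
Proof.
rewrite [RHS](exchange_big_dep xpredT) //=.
rewrite [RHS](bigID (fun w => (0 < abox_row w)%N)) /=.
rewrite [X in _ = _ * X]big1 ?mulr1 => [|w /negPf w0]; last first.
  by rewrite big1 // => v _; rewrite w0 andbF.
rewrite prod_up; apply: eq_bigr => u _; rewrite -big_mkcondr /=.
by apply: eq_bigl => v; rewrite andbT arm_near_up.
Qed.

Lemma prod_arm_down (G : abox -> abox -> F) :
  \prod_u \prod_(v in arm u) G (down u) v =
  \prod_v \prod_(w | near v w) (if shorter w v then G v w else 1).
Proof.
under [RHS]eq_bigr do rewrite -big_mkcondr /=.
rewrite [RHS](bigID (fun v => (abox_row v < gamma (abox_col v))%N)) /=.
rewrite [X in _ = _ * X]big1 ?mulr1 => [|v top]; last first.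
  rewrite big1 // => w /andP[vw]; apply: contraTeq => _.
  apply: top_not_shorter vw; apply/eqP.
  by rewrite eqn_leq row_le leqNgt.
rewrite prod_down; apply: eq_bigr => u _; apply: eq_bigl => v.
exact: arm_near_down.
Qed.

Lemma weightE f : weight f =
  \prod_v \prod_(w | near v w) att (f v) (f w) *
  \prod_u vert (hook (up u)) (f (down u)) (f (up u)).
Proof.
rewrite -(prod_above (fun v w => vert (hook w) (f v) (f w))) -big_split /=.
apply: eq_bigr => v _; rewrite big_mkcond [X in _ = X * _]big_mkcond.
rewrite [X in _ = _ * X]big_mkcond -big_split /=.
apply: eq_bigr => w _; rewrite /pair_weight /near /above.
have n0 : (0 < n)%N by apply: leq_ltn_trans (ltn_ord (abox_col v)).
have [e|ne] := eqVneq (pos w) (pos v + n)%N.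
  have vn : (pos v < pos v + n)%N by lia.
  by rewrite e ltnn andbF vn mul1r.
by rewrite mulr1; case: ltnP => //=; case: ifP.
Qed.

End PairWeights.

(** * Comparison of the filling weight with the pair weight *)

Section Factorization.

Variables (F : fieldType) (n : nat) (q t : F) (gamma : 'I_n -> nat).
Variables (tau : 'S_n).
Hypothesis t_neq0 : t != 0.
Local Notation abox := (abox gamma).
Local Notation box := (box gamma).
Implicit Types (v w : abox) (u : box) (sigma : filling gamma).

Definition ascent_factor (c d : 'I_n) : F := if (c < d)%N then t^-1 else 1.

Lemma ascent_factor_neq0 c d : ascent_factor c d != 0.
Proof. by rewrite /ascent_factor; case: ifP; rewrite ?invr_eq0 ?oner_neq0. Qed.

(* [chi_uv + chi_vw - chi_uw] is [0] or [1], so that a coinversion is counted by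
   [1 - chi_uv - chi_vw + chi_uw]. *)
Lemma expr_coinvtrip sigma (f := augment tau sigma) :
  t ^+ coinvtrip tau sigma = \prod_u \prod_(v in arm u)
    (t * ascent_factor (f v) (f (up u)) * ascent_factor (f (down u)) (f v) *
     (if (f (down u) < f (up u))%N then t else 1)).
Proof.
rewrite /coinvtrip -prodr_const pair_big_dep.
rewrite [LHS](eq_bigl _ _ (in_set _)) big_mkcondr /=.
apply: eq_bigr => -[u v] _ /=; rewrite /chi /ascent_factor -/f.
move: (f (up u)) (f v) (f (down u)) => a b c.
case: (ltnP b a) => ba; case: (ltnP c b) => cb; case: (ltnP c a) => ca //=;
  rewrite ?mulr1 ?mulfV ?mulfVK ?mul1r ?mulKf //; try lia.
Qed.

Definition basement_const : F :=
  \prod_(v : abox) \prod_(w | near v w)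
     if (abox_row w == 0%N) && shorter v w
     then ascent_factor (tau (abox_col v)) (tau (abox_col w)) else 1.

Definition triple_const : F := \prod_(u : box) \prod_(v in arm u) t.

Definition norm_const : F := triple_const / basement_const.

Lemma basement_const_neq0 : basement_const != 0.
Proof.
apply/prodf_neq0 => v _; apply/prodf_neq0 => w _.
by case: ifP; rewrite ?ascent_factor_neq0 ?oner_neq0.
Qed.

Lemma norm_const_neq0 : norm_const != 0.
Proof.
rewrite mulf_neq0 ?invr_eq0 ?basement_const_neq0 //.
by apply/prodf_neq0 => u _; apply/prodf_neq0.
Qed.

Lemma augment_basement sigma v : abox_row v = 0%N ->
  augment tau sigma v = tau (abox_col v).
Proof.
case: v => i j; rewrite /abox_row /augment /= => j0.
by case: unliftP => // k e; move: j0; rewrite e.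
Qed.

(** A near pair whose earlier box is in the shorter column is an arm box with [up u]; otherwise it
    is [down u] with an arm box. Each near pair arises once in this way, except those inside the
    basement whose earlier box is the shorter: they make up [basement_const]. *)
Lemma prod_ascents sigma (f := augment tau sigma) :
  \prod_(v : abox) \prod_(w | near v w) ascent_factor (f v) (f w) =
  basement_const *
  (\prod_u \prod_(v in arm u) ascent_factor (f v) (f (up u)) *
   \prod_u \prod_(v in arm u) ascent_factor (f (down u)) (f v)).
Proof.
rewrite (prod_arm_up (fun v w => ascent_factor (f v) (f w))).
rewrite (prod_arm_down (fun v w => ascent_factor (f v) (f w))).
rewrite -!big_split /=; apply: eq_bigr => v _.
rewrite -!big_split /=; apply: eq_bigr => w vw.
rewrite (shorterN (near_col vw)); case: (shorter v w) => /=; last first.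
  by rewrite andbF !mul1r.
rewrite andbT lt0n; case: eqP => [w0|] /=; rewrite ?mulr1 ?mul1r //.
have v0 : abox_row v = 0%N.
  by move: vw; rewrite /near pos_lt w0 ltn0 /= => /andP[/andP[/eqP]].
by rewrite /f !augment_basement.
Qed.

Definition filling_weight sigma : F :=
  q ^+ maj tau sigma * t ^+ coinvtrip tau sigma *
  \prod_(u : box | augment tau sigma (up u) != augment tau sigma (down u))
     ((1 - t) / (1 - q ^+ (leg u).+1 * t ^+ #|arm u|.+1)).

Lemma nonattackingE sigma (f := augment tau sigma) :
  nonattacking tau sigma = [forall v, forall w, near v w ==> (f v != f w)].
Proof.
apply/forallP/forallP => na v; apply/forallP => w.
  by have := forallP (na v) w; rewrite attackingE => na1; apply/implyP => vw;
     move: na1; rewrite vw.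
rewrite attackingE; apply/implyP => /orP[]; first exact/implyP/(forallP (na v)).
by rewrite eq_sym; apply/implyP/(forallP (na w)).
Qed.

(** Since [att] vanishes on equal entries, [weight] itself enforces the non-attacking condition. On
    the remaining fillings the ascents along near pairs rebuild the coinversion factors. *)
Lemma filling_weightE sigma :
  (nonattacking tau sigma)%:R * filling_weight sigma =
  norm_const * weight q t (augment tau sigma).
Proof.
set f := augment tau sigma.
have -> : weight q t f = (nonattacking tau sigma)%:R *
    (\prod_(v : abox) \prod_(w | near v w) ascent_factor (f v) (f w) *
     \prod_u vert t (hook q t (up u)) (f (down u)) (f (up u))).
  rewrite weightE mulrA; congr (_ * _); rewrite nonattackingE -/f.
  case: (boolP [forall v, _]) => [/forallP na|].
    rewrite mul1r; apply: eq_bigr => v _; apply: eq_bigr => w vw.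
    by rewrite /att (negPf (implyP (forallP (na v) w) vw)).
  rewrite negb_forall => /existsP[v]; rewrite negb_forall => /existsP[w].
  rewrite negb_imply negbK => /andP[vw fvw].
  by rewrite (bigD1 v) //= (bigD1 w) //= /att fvw !mul0r.
have := prod_ascents sigma; rewrite -/f [RHS]mulrCA => ->; congr (_ * _).
rewrite /norm_const !mulrA divfK ?basement_const_neq0 // /triple_const.
rewrite /filling_weight expr_coinvtrip -/f.
rewrite /maj (big_morph _ (exprD q) (expr0 q)) -/f.
rewrite [X in X * _ * _ = _]big_mkcond [X in _ * X = _]big_mkcond -!big_split /=.
apply: eq_bigr => u _.
have card_arm : #|arm u| = #|[set v | near v (up u) && shorter v (up u)]|.
  by apply: eq_card => v; rewrite arm_near_up inE.
rewrite !big_split /= prodr_const /vert /hook -card_arm.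
rewrite -[(_ - _)%N]/(leg u) [t ^+ _.+1]exprSr.
set L := q ^+ _; set A := t ^+ _; rewrite [L * (A * t)]mulrA [f (up u) == _]eq_sym.
set X := \prod_(_ in _) _; set Y := \prod_(_ in _) _.
case: (ltngtP (f (down u)) (f (up u))) => [lt|lt|/val_inj->] /=.
- have /negPf -> : f (down u) != f (up u).
    by rewrite -(inj_eq val_inj) /= ltn_eqF.
  by rewrite prodr_const -/A /=; ring.
- have /negPf -> : f (down u) != f (up u).
    by rewrite -(inj_eq val_inj) /= gtn_eqF.
  by rewrite prodr_const expr1n /=; ring.
- by rewrite eqxx prodr_const expr1n /=; ring.
Qed.

End Factorization.

(** * Transfer matrices for two adjacent entries *)

Section Transfer.

Variables (F : fieldType) (n : nat) (q t : F) (gamma : 'I_n -> nat).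
Variables (k : 'I_n).
Hypothesis k_lt : (k.+1 < n)%N.

Local Notation abox := (abox gamma).
Local Notation K := (ratfun F n).
Local Notation k' := (ordS k).
Implicit Types (v w z : abox) (l : seq abox) (c d : 'I_n).
Implicit Types (f : {ffun abox -> 'I_n}).

Definition pw v w c d : K := cst (pair_weight q t v w c d).

Definition xw v c : K := if abox_row v == 0%N then 1 else var c.

Fixpoint chain_weight f l : K :=
  if l is v :: l' then
    xw v (f v) * \prod_(w <- l') pw v w (f v) (f w) * chain_weight f l'
  else 1.

(** The product of the transfer matrices, applied to the all-ones vector: the sum over colourings of
    [l] when [v] has colour [c]. The factor on the head of [l'] kills the case of three mutually
    attacking boxes. *)
Fixpoint transfer v l c : K :=
  if l is w :: l' then
    (if ohead l' is Some z then (~~ near v z)%:R else 1) *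
    (pw v w c k * xw w k * transfer w l' k +
     pw v w c k' * xw w k' * transfer w l' k')
  else 1.

Definition pos_sorted l := sorted (fun v w => pos v < pos w)%N l.

Definition recoloring f0 l f :=
  [forall v, if v \in l then (f v == k) || (f v == k') else f v == f0 v].

Lemma cst0 : cst 0 = 0 :> K. Proof. exact: (rmorph0 (@cst F n)). Qed.
Lemma cst1 : cst 1 = 1 :> K. Proof. exact: (rmorph1 (@cst F n)). Qed.

Lemma pos_trans : transitive (fun v w => pos v < pos w)%N.
Proof. by move=> w v z; apply: ltn_trans. Qed.

(* Only consecutive boxes interact: if [v] and the box [z] two steps above attack
   each other, so does each of them and [w], and two colours do not suffice; if
   [z] is vertically above [v], then [w] forces them to have the same colour. *)
Lemma chain_weight_cons f v w l : pos_sorted [:: v, w & l] ->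
  {in [:: v, w & l], forall z, (f z == k) || (f z == k')} ->
  chain_weight f [:: v, w & l] =
  (if ohead l is Some z then (~~ near v z)%:R else 1) * xw v (f v) *
  pw v w (f v) (f w) * chain_weight f (w :: l).
Proof.
case: l => [|z l] sl fk; first by rewrite /= big_cons big_nil; ring.
have vw : (pos v < pos w)%N by case/andP: sl.
have wz : (pos w < pos z)%N by case/and3P: sl.
have far : {in l, forall r, pos z < pos r}%N.
  by move: sl => /and3P[_ _] /(order_path_min pos_trans) /allP.
have [kv kw kz] : [/\ (f v == k) || (f v == k'), (f w == k) || (f w == k')
                    & (f z == k) || (f z == k')].
  by split; apply: fk; rewrite !inE eqxx ?orbT.
rewrite [LHS]/= !big_cons; set R := \prod_(r <- l) pw v r _ _.
rewrite [chain_weight f (w :: _)]/= big_cons; set S := \prod_(r <- l) _.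
set C := xw z _ * _ * _.
have zero_near r s : near r s -> f r = f s -> pw r s (f r) (f s) = 0.
  by move=> rs e; rewrite /pw /pair_weight rs /att e eqxx cst0.
have [vz|Nvz] := boolP (near v z) => /=.
  have nvw : near v w.
    by move: vz; rewrite /near vw => /andP[_]; apply: ltn_trans.
  have nwz : near w z.
    move: vz; rewrite /near wz => /andP[_ lt]; apply: ltn_trans lt _.
    by rewrite ltn_add2r.
  rewrite vz mulr0n !mul0r.
  have [e|e1] := eqVneq (f v) (f w); first by rewrite (zero_near v w) //; ring.
  have [e|e2] := eqVneq (f w) (f z); first by rewrite (zero_near w z) //; ring.
  have [e|e3] := eqVneq (f v) (f z); first by rewrite (zero_near v z) //; ring.
  by move: kv kw kz e1 e2 e3 => /orP[]/eqP-> /orP[]/eqP-> /orP[]/eqP->;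
    rewrite ?eqxx.
have zn : (pos v + n <= pos z)%N.
  by move: Nvz; rewrite /near (ltn_trans vw wz) /= -leqNgt.
(* The boxes after [z] are at distance more than [n] from [v], so they neither attack it nor lie
   directly above it. *)
have -> : R = 1.
  rewrite /R big_seq big1 // => r /far zr; have vr := leq_ltn_trans zn zr.
  have Nnr : near v r = false by rewrite /near; lia.
  by rewrite /pw /pair_weight Nnr /above gtn_eqF // cst1.
have [avz|Navz] := boolP (above v z); last first.
  rewrite [pw v z _ _]/pw /pair_weight (negPf Nvz) (negPf Navz).
  by rewrite cst1 /=; ring.
have ez : pos z = (pos v + n)%N by apply/eqP.
have nvw : near v w by rewrite /near vw -ez.
have nwz : near w z by rewrite /near wz ez ltn_add2r.
have [e|e1] := eqVneq (f v) (f w); first by rewrite (zero_near v w) //; ring.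
have [e|e2] := eqVneq (f w) (f z); first by rewrite (zero_near w z) //; ring.
have e : f v = f z.
  by move: kv kw kz e1 e2 => /orP[]/eqP-> /orP[]/eqP-> /orP[]/eqP->;
    rewrite ?eqxx.
rewrite [pw v z _ _]/pw /pair_weight (negPf Nvz) avz /vert e eqxx.
by rewrite cst1 /=; ring.
Qed.

Lemma recoloring_cons f0 w l f c : w \notin l -> (c == k) || (c == k') ->
  recoloring f0 (w :: l) f && (f w == c) =
  recoloring [ffun z => if z == w then c else f0 z] l f.
Proof.
move=> wl ck; apply/andP/forallP => [[/forallP rf /eqP fw] z|rf].
  have := rf z; rewrite inE ffunE; have [->|_] //= := eqVneq z w.
  by rewrite (negPf wl) fw eqxx.
have fw : f w = c by have := rf w; rewrite (negPf wl) ffunE eqxx => /eqP.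
split; last by rewrite fw.
apply/forallP => z; have := rf z; rewrite inE ffunE.
by have [->|_] //= := eqVneq z w; rewrite fw ck.
Qed.

Lemma sum_recoloring_cons (G : {ffun abox -> 'I_n} -> K) f0 w l : w \notin l ->
  \sum_(f | recoloring f0 (w :: l) f) G f =
  \sum_(f | recoloring [ffun z => if z == w then k else f0 z] l f) G f +
  \sum_(f | recoloring [ffun z => if z == w then k' else f0 z] l f) G f.
Proof.
move=> wl; rewrite (bigID (fun f : {ffun abox -> 'I_n} => f w == k)) /=.
congr (_ + _); apply: eq_bigl => f; rewrite -recoloring_cons ?eqxx ?orbT //.
apply: andb_id2l => /forallP/(_ w); rewrite mem_head => /orP[]/eqP->.
  by rewrite eqxx eq_sym (negPf (ordS_neq k_lt)).
by rewrite eqxx (ordS_neq k_lt).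
Qed.

Lemma recoloring_mem f0 l f v :
  recoloring f0 l f -> v \notin l -> f v = f0 v.
Proof. by move=> /forallP/(_ v) + vl; rewrite (negPf vl) => /eqP. Qed.

(** By induction on [l]: splitting on the colour of the next box turns [chain_weight_cons] into one
    matrix step. *)
Lemma sum_chain_weight f0 v l : pos_sorted (v :: l) ->
  (f0 v == k) || (f0 v == k') ->
  \sum_(f | recoloring f0 l f) chain_weight f (v :: l) =
  xw v (f0 v) * transfer v l (f0 v).
Proof.
elim: l f0 v => [|w l IH] f0 v sl kv.
  rewrite (big_pred1 f0) /= ?big_nil ?mulr1 // => f.
  apply/forallP/eqP => [rf|-> w] //; apply/ffunP => w; exact/eqP/rf.
have [vw sl'] := andP sl.
have ml : {in w :: l, forall r, pos v < pos r}%N.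
  exact/allP/(order_path_min pos_trans sl).
have vl : v \notin w :: l by apply/negP => /ml; rewrite ltnn.
have wl : w \notin l.
  by apply/negP => /(allP (order_path_min pos_trans sl')); rewrite ltnn.
have ck (c : 'I_n) : (c == k) || (c == k') ->
  \sum_(f | recoloring [ffun z => if z == w then c else f0 z] l f)
     chain_weight f [:: v, w & l] =
  (if ohead l is Some z then (~~ near v z)%:R else 1) * xw v (f0 v) *
  pw v w (f0 v) c * (xw w c * transfer w l c).
  move=> kc; set f1 := [ffun z => _].
  have e1 : f1 w = c by rewrite ffunE eqxx.
  have := IH f1 w sl'; rewrite e1 => /(_ kc) <-; rewrite mulr_sumr.
  apply: eq_bigr => f rf.
  have fw : f w = c by rewrite (recoloring_mem rf wl).
  have fv : f v = f0 v.
    move: vl; rewrite inE => /norP[nvw vl].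
    by rewrite (recoloring_mem rf vl) ffunE (negPf nvw).
  rewrite chain_weight_cons // ?fv ?fw // => z; rewrite !inE.
  case/or3P=> [/eqP->|/eqP->|zl]; rewrite ?fv ?fw //.
  by move/forallP: rf => /(_ z); rewrite zl.
rewrite sum_recoloring_cons // !ck ?eqxx ?orbT //= ; ring.
Qed.

Local Notation x := (var k : K).
Local Notation y := (var k' : K).

Definition swap_sym (f : K) := s k f = f.

Lemma swap_symM (f g : K) : swap_sym f -> swap_sym g -> swap_sym (f * g).
Proof. by rewrite /swap_sym rmorphM /= => -> ->. Qed.

Lemma swap_symD (f g : K) : swap_sym f -> swap_sym g -> swap_sym (f + g).
Proof. by rewrite /swap_sym rmorphD /= => -> ->. Qed.

Lemma swap_sym_cst (a : F) : swap_sym (cst a).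
Proof. exact: s_cst. Qed.

Lemma swap_sym_nat m : swap_sym m%:R.
Proof. by rewrite /swap_sym rmorph_nat. Qed.

Lemma swap_sym1 : swap_sym 1.
Proof. exact: (swap_sym_nat 1). Qed.

Lemma swap_symxy : swap_sym (x * y).
Proof. by rewrite /swap_sym rmorphM /= !s_var tpermL tpermR mulrC. Qed.

Lemma swap_symxDy : swap_sym (x + y).
Proof. by rewrite /swap_sym rmorphD /= !s_var tpermL tpermR addrC. Qed.

Lemma swap_sym_var d : d != k -> d != k' -> swap_sym (var d).
Proof. by move=> dk dk'; rewrite /swap_sym s_var tpermD // eq_sym. Qed.

Hypothesis t_neq0 : t != 0.
Hypothesis hook_neq1 : forall w : abox, 1 - hook q t w * t != 0.

(* The pairs [(B + y A, B + t x A)] with [A] and [B] symmetric in [x], [y]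
   form a space that contains [(1, 1)] and is stable under the three kinds of
   transfer matrices: attacking, vertically adjacent and unrelated boxes. *)
Lemma transfer_shape v l : pos_sorted (v :: l) ->
  all (fun w => 0 < abox_row w)%N l ->
  exists A B : K, [/\ swap_sym A, swap_sym B, transfer v l k = B + y * A
                    & transfer v l k' = B + cst t * x * A].
Proof.
elim: l v => [|w l IH] v sl rl.
  exists 0, 1; split; rewrite /= ?mulr0 ?addr0 //; last exact: swap_sym1.
  by rewrite /swap_sym rmorph0.
have [vw sl'] := andP sl; have [w0 rl'] := andP rl.
have [A [B [symA symB hk hk']]] := IH w sl' rl'.
pose delta : K := if ohead l is Some z then (~~ near v z)%:R else 1.
rewrite /= -/delta hk hk' /xw eqn0Ngt w0 /=.
have symd : swap_sym delta.
  by rewrite /delta; case: (ohead l) => [z|]; [exact: swap_sym_nat | exact: swap_sym1].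
have kk' : (k == k') = false by rewrite eq_sym; apply/negbTE/(ordS_neq k_lt).
have k'k : (k' == k) = false by apply/negbTE/(ordS_neq k_lt).
have ltkk' : (k < k')%N by rewrite (val_ordS_lt k_lt).
have ltk'k : (k' < k)%N = false by rewrite ltnNge ltnW.
rewrite /pw /pair_weight; case: (near v w) => /=.
  rewrite /att !eqxx kk' k'k ltkk' ltk'k cst0 cst1.
  (* The matrix is antidiagonal, so [A] and [B] exchange roles. *)
  exists (delta * cst t^-1 * B), (delta * (x * y * A)); split.
  - by do ?apply: swap_symM => //; apply: swap_sym_cst.
  - by do 2!apply: swap_symM => //; apply: swap_symxy.
  - transitivity (delta * (cst t^-1 * y * B + cst t * cst t^-1 * (x * y * A))).
      by ring.
    by rewrite cst_tV //; ring.
  - transitivity (delta * (cst t * cst t^-1 * x * B + x * y * A)); last by ring.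
    by rewrite cst_tV //; ring.
case: (above v w) => /=; last first.
  (* All matrix entries are 1, so both sums agree and the new [A] is 0. *)
  exists 0, (delta * ((x + y) * B + (1 + cst t) * (x * y * A))); split.
  - by rewrite /swap_sym rmorph0.
  - apply: swap_symM => //; apply: swap_symD; apply: swap_symM => //.
    + exact: swap_symxDy.
    + by apply: swap_symD; [exact: swap_sym1 | exact: swap_sym_cst].
    + by apply: swap_symM => //; apply: swap_symxy.
  - by rewrite cst1; ring.
  - by rewrite cst1; ring.
set Q := hook q t w; have Q1 : 1 - Q * t != 0 by apply: hook_neq1.
(* With this [r] the vertical matrix is the all-ones matrix plus [t * r] times the attacking one, so
   this case combines the two others. *)
pose r := (Q - 1) / (1 - Q * t).
have e1 : vert t Q k k' = 1 + r.
  by rewrite /vert kk' ltkk' /r; field.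
have e2 : vert t Q k' k = 1 + t * r.
  by rewrite /vert k'k ltk'k /r; field.
rewrite e1 e2 /vert !eqxx cst1.
have -> : cst (1 + r) = 1 + cst r :> K by rewrite rmorphD /= cst1.
have -> : cst (1 + t * r) = 1 + cst t * cst r :> K.
  by rewrite rmorphD rmorphM /= cst1.
exists (delta * (cst r * B)), (delta * ((x + y) * B +
  (1 + cst t + cst t * cst r) * (x * y * A))); split; try by ring.
  by do ?apply: swap_symM => //; apply: swap_sym_cst.
apply: swap_symM => //; apply: swap_symD; apply: swap_symM => //.
- exact: swap_symxDy.
- apply: swap_symD; last by apply: swap_symM; apply: swap_sym_cst.
  by apply: swap_symD; [exact: swap_sym1 | exact: swap_sym_cst].
- by apply: swap_symM => //; apply: swap_symxy.
Qed.

(** [T t k] commutes with multiplication by symmetric functions and sends 1 to [t] and [x] to [y].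
    The factor [t^-1] is the weight of the ascent formed by [k] and [k'] in the basement. *)
Lemma T_shape M A B : swap_sym M -> swap_sym A -> swap_sym B ->
  T t k (M * (cst t^-1 * (B + cst t * x * A))) = M * (B + y * A).
Proof.
move=> symM symA symB; rewrite mulrCA T_cstM /T.
have sf : s k (M * (B + cst t * x * A)) = M * (B + cst t * y * A).
  by rewrite rmorphM rmorphD !rmorphM /= symM symA symB s_cst s_var tpermL.
rewrite sf -mulrBr; set d := 1 - _.
have -> : M * (B + cst t * x * A - (B + cst t * y * A)) / d =
    cst t * M * A * ((x - y) / d) by ring.
rewrite /d divdiff_var ?var_neq0 ?var_ordS // rmorphB /= cst1.
transitivity (cst t * cst t^-1 * (M * (B + y * A))); first by ring.
by rewrite cst_tV // mul1r.
Qed.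

End Transfer.

(** * The polynomial as a sum of pair weights *)

Section PairModel.

Variables (F : fieldType) (n : nat) (q t : F) (gamma : 'I_n -> nat).
Hypothesis t_neq0 : t != 0.
Local Notation abox := (abox gamma).
Local Notation K := (ratfun F n).
Implicit Types (f rho : {ffun abox -> 'I_n}) (tau : 'S_n) (v w : abox).

Definition has_basement tau f :=
  [forall v, (abox_row v == 0%N) ==> (f v == tau (abox_col v))].

Definition monomial f : K := \prod_(v | (0 < abox_row v)%N) var (f v).

Definition pair_model tau : K :=
  \sum_(f | has_basement tau f) cst (weight q t f) * monomial f.

Lemma augment_up tau (sigma : filling gamma) u : augment tau sigma (up u) = sigma u.
Proof. by case: u => i j; rewrite /augment /up /= liftK. Qed.

(** Augmentation and restriction are inverse bijections; the attacking fillings that appear only in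
    [pair_model] have weight 0. *)
Lemma permuted_basement_E_pair_model tau :
  of_mpoly (permuted_basement_E q t gamma tau) =
  cst (norm_const t gamma tau) * pair_model tau.
Proof.
rewrite /permuted_basement_E raddf_sum /pair_model.
pose aug sigma : {ffun abox -> 'I_n} := [ffun v => augment tau sigma v].
pose res (f : {ffun abox -> 'I_n}) : filling gamma := [ffun u => f (up u)].
rewrite [in RHS](reindex_onto aug res) => [|f /forallP bf]; last first.
  apply/ffunP => v; rewrite ffunE; case: (posnP (abox_row v)) => [v0|].
    by rewrite augment_basement //; have := bf v; rewrite v0 => /eqP.
  by case/row_gt0P => u ->; rewrite augment_up ffunE.
rewrite mulr_sumr big_mkcond [RHS](eq_bigl xpredT) => [|sigma]; last first.
  apply/andP; split; last first.
    by apply/eqP/ffunP => u; rewrite !ffunE augment_up.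
  apply/forallP => v; apply/implyP => /eqP v0.
  by rewrite ffunE augment_basement.
apply: eq_bigr => sigma _.
have -> : weight q t (aug sigma) = weight q t (augment tau sigma).
  by apply: eq_bigr => v _; apply: eq_bigr => w _; rewrite !ffunE.
rewrite mulrA -rmorphM /= -filling_weightE // rmorphM /= rmorph_nat.
case: nonattacking => /=; last by rewrite !mul0r.
rewrite mul1r -mul_mpolyC rmorphM; congr (_ * _); rewrite rmorph_prod /=.
rewrite /monomial (prod_up (fun v => var (aug sigma v))).
by apply: eq_bigr => u _; rewrite ffunE augment_up.
Qed.

End PairModel.

(** * The action of [T_k] on the pair model *)

Section BasementSwap.

Variables (F : fieldType) (n : nat) (q t : F) (gamma : 'I_n -> nat).
Variables (k : 'I_n).
Hypothesis (t_neq0 : t != 0) (k_lt : (k.+1 < n)%N).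
Hypothesis hook_neq1 : forall w : abox gamma, 1 - hook q t w * t != 0.

Local Notation abox := (abox gamma).
Local Notation K := (ratfun F n).
Local Notation k' := (ordS k).
Implicit Types (f rho : {ffun abox -> 'I_n}) (tau : 'S_n) (v w : abox).
Implicit Types (c d : 'I_n) (l : seq abox).

Let kk' : k' = k.+1 :> nat := val_ordS_lt k_lt.
Let k'_neq : k' != k := ordS_neq k_lt.

Lemma T_sum (I : finType) (P : pred I) (G : I -> K) :
  T t k (\sum_(i | P i) G i) = \sum_(i | P i) T t k (G i).
Proof.
apply: (big_morph (T t k)) => [f g|].
  rewrite /T !rmorphD /=; set z := _^-1; ring.
by rewrite /T rmorph0 subr0 mul0r !mulr0 addr0.
Qed.

Definition merge c := if c == k' then k else c.

Lemma merge_eqk c : (merge c == k) = (c == k) || (c == k').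
Proof.
by rewrite /merge; case: (eqVneq c k') => [->|] /=; rewrite ?eqxx ?orbT ?orbF.
Qed.

Lemma merge_k : merge k = k.
Proof. by rewrite /merge eq_sym (negPf k'_neq). Qed.

Lemma merge_k' : merge k' = k.
Proof. by rewrite /merge eqxx. Qed.

Lemma merge_neqk' c : merge c != k'.
Proof. by rewrite /merge; case: ifP => [_|->//]; rewrite eq_sym. Qed.

Lemma merge_id c : merge c != k -> merge c = c.
Proof. by rewrite /merge; case: ifP => //; rewrite eqxx. Qed.

(** No entry lies strictly between [k] and [k'], so identifying them alters only comparisons within
    this pair. *)
Lemma merge_cmp c d : ~~ ((merge c == k) && (merge d == k)) ->
  (merge c == merge d) = (c == d) /\ (merge c < merge d)%N = (c < d)%N.
Proof.
rewrite /merge; move: (ordS k) kk' => m mk.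
case: (eqVneq c m) => [->|]; case: (eqVneq d m) => [->|];
  rewrite -!val_eqE /= ?eqxx //=; lia.
Qed.

(** The data held fixed when fillings are grouped: the other entries and the set of boxes coloured
    by [k] or [k']. *)
Definition skeleton f : {ffun abox -> 'I_n} := [ffun v => merge (f v)].

Lemma chain_weight_seq f l : pos_sorted l ->
  chain_weight q t f l =
  \prod_(v <- l) xw F v (f v) *
  \prod_(v <- l) \prod_(w <- l | (pos v < pos w)%N) pw q t v w (f v) (f w).
Proof.
elim: l => [|v l IH] sl; first by rewrite /= !big_nil mulr1.
have ml := allP (order_path_min (@pos_trans n gamma) sl).
rewrite /= (IH (path_sorted sl)) !big_cons ltnn.
have -> : \prod_(w <- l | (pos v < pos w)%N) pw q t v w (f v) (f w) =
          \prod_(w <- l) pw q t v w (f v) (f w).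
  by rewrite big_seq_cond [RHS]big_seq; apply: eq_bigl => w;
     case: (boolP (w \in l)) => //= /ml.
rewrite mulrACA; congr (_ * (_ * _)); rewrite big_seq [RHS]big_seq.
by apply: eq_bigr => w /ml vw; rewrite big_cons ltnNge ltnW.
Qed.

Lemma chain_weightE f l : pos_sorted l ->
  chain_weight q t f l =
  \prod_(v in l) xw F v (f v) *
  \prod_(v in l) \prod_(w in l | (pos v < pos w)%N) pw q t v w (f v) (f w).
Proof.
move=> sl; have ul : uniq l.
  by apply: sorted_uniq sl => [|v]; [exact: pos_trans | rewrite ltnn].
rewrite chain_weight_seq // !big_uniq //; congr (_ * _).
apply: eq_bigr => v _.
by rewrite big_mkcond big_uniq // [RHS]big_mkcondr.
Qed.

Definition skeleton_const rho : K :=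
  \prod_v \prod_(w | (pos v < pos w)%N && ~~ ((rho v == k) && (rho w == k)))
     pw q t v w (rho v) (rho w) *
  \prod_(v | (0 < abox_row v)%N && (rho v != k)) var (rho v).

Lemma skeleton_const_sym rho : (forall v, rho v != k') ->
  swap_sym k (skeleton_const rho).
Proof.
move=> rk'; apply: swap_symM.
  apply: big_ind => [||v _]; [exact: swap_sym1 | exact: swap_symM|].
  apply: big_ind => [||w _]; [exact: swap_sym1 | exact: swap_symM|].
  exact: swap_sym_cst.
apply: big_ind => [||v /andP[_ vk]]; [exact: swap_sym1 | exact: swap_symM|].
exact: swap_sym_var.
Qed.

Lemma weight_monomial f l (rho := skeleton f) : pos_sorted l ->
  (forall v, (v \in l) = (rho v == k)) ->
  cst (weight q t f) * monomial F f = skeleton_const rho * chain_weight q t f l.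
Proof.
move=> sl ml; rewrite chain_weightE // /skeleton_const [X in _ = _ * X]mulrC mulrACA.
have rhoE v : rho v = merge (f v) by rewrite ffunE.
congr (_ * _).
  rewrite /weight rmorph_prod [in X in _ = _ * X]big_mkcond -big_split /=.
  apply: eq_bigr => v _; rewrite rmorph_prod /= ml.
  (* By [merge_cmp], pairs not contained in [l] see only the skeleton; the remaining pairs belong to
     the chain. *)
  rewrite (bigID (fun w => ~~ ((rho v == k) && (rho w == k)))) /=.
  congr (_ * _).
    apply: eq_bigr => w /andP[_]; rewrite !rhoE => /merge_cmp[e1 e2].
    by rewrite /pw /pair_weight /att /vert e1 e2.
  have [vk|_] := boolP (rho v == k); last by rewrite big_pred0 // => w; rewrite andbF.
  by apply: eq_bigl => w; rewrite negbK ml andbC.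
rewrite /monomial (bigID (fun v => rho v != k)) /=; congr (_ * _).
  by apply: eq_bigr => v /andP[_]; rewrite rhoE => /merge_id ->.
rewrite (eq_bigl _ _ ml) [RHS]big_mkcond [LHS]big_mkcond /=; apply: eq_bigr => v _.
by rewrite negbK /xw; case: (abox_row v); case: ifP.
Qed.

Lemma recoloring_skeleton tau rho l f :
  let f0 := [ffun v => if abox_row v == 0%N then tau (abox_col v) else rho v] in
  (forall v, rho v != k') ->
  (forall v, abox_row v = 0%N -> rho v = merge (tau (abox_col v))) ->
  (forall v, (v \in l) = (rho v == k) && (0 < abox_row v)%N) ->
  recoloring k f0 l f = has_basement tau f && (skeleton f == rho).
Proof.
move=> f0 rk' rb ml; apply/forallP/andP => [rf|[/forallP bf /eqP sf] v].
  have bf v : abox_row v = 0%N -> f v = tau (abox_col v).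
    by move=> v0; have := rf v; rewrite ml v0 andbF ffunE v0 /= => /eqP.
  split; first by apply/forallP => v; apply/implyP => /eqP /bf ->.
  apply/eqP/ffunP => v; rewrite ffunE.
  have [v0|v0] := posnP (abox_row v); first by rewrite bf // rb.
  have := rf v; rewrite ml v0 andbT ffunE eqn0Ngt v0 /= -merge_eqk.
  have [->|_ /eqP ->] := eqVneq (rho v) k; first by move/eqP.
  by rewrite /merge (negPf (rk' v)).
have rE : rho v = merge (f v) by rewrite -sf ffunE.
rewrite ml; have [v0|v0] := posnP (abox_row v).
  by rewrite andbF ffunE v0; have := bf v; rewrite v0.
rewrite andbT rE merge_eqk; case: (boolP (_ || _)) => //.
rewrite -merge_eqk => /merge_id e.
by rewrite ffunE eqn0Ngt v0 /= rE e.
Qed.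

(** It holds skeleton by skeleton: the two basements give the same chain above row 0, entered with
    opposite colours, and [T_shape] relates the two results. *)
Lemma T_pair_model tau : (tau^-1%g k < tau^-1%g k')%N ->
  T t k (pair_model q t gamma tau) =
  pair_model q t gamma (tau * tperm k k')%g.
Proof.
move=> lt_tau; set tau' := (tau * _)%g.
have mtau' c : merge (tau' c) = merge (tau c).
  rewrite permM /merge; case: tpermP => [->|->|//]; rewrite eqxx.
    by rewrite eq_sym (negPf k'_neq).
  by rewrite eq_sym (negPf k'_neq).
rewrite /pair_model (partition_big skeleton xpredT) //= T_sum.
rewrite [RHS](partition_big skeleton xpredT) //=.
apply: eq_bigr => rho _.
(* A skeleton failing this test comes from no filling with either basement, so both sums are
   empty. *)
have [rho_ok|rho_bad] := boolP ([forall v, rho v != k'] &&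
  [forall v, (abox_row v == 0%N) ==> (rho v == merge (tau (abox_col v)))]);
  last first.
  have none tau1 : (forall c, merge (tau1 c) = merge (tau c)) ->
    (fun f => has_basement tau1 f && (skeleton f == rho)) =1 xpred0.
    move=> e f; apply: contraNF rho_bad => /andP[/forallP bf /eqP <-].
    apply/andP; split; apply/forallP => v; first by rewrite ffunE merge_neqk'.
    apply/implyP => v0; rewrite ffunE -e; have := bf v.
    by rewrite v0 => /eqP ->.
  by rewrite !big_pred0 //; [rewrite /T rmorph0 subr0 mul0r !mulr0 addr0
    | exact: none | exact: none].
have [/forallP rk' /forallP rb0] := andP rho_ok.
have rb v : abox_row v = 0%N -> rho v = merge (tau (abox_col v)).
  by move=> v0; have := rb0 v; rewrite v0 => /eqP.
pose base c : abox := Tagged (fun i => 'I_(gamma i).+1) (ord0 : 'I_(gamma c).+1).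
(* These basement boxes start the chain; they hold [k], [k'] under [tau] and [k'], [k] under
   [tau']. *)
pose a := base (tau^-1%g k); pose b := base (tau^-1%g k').
pose le_pos v w := (pos v <= pos w)%N.
pose l := sort le_pos (enum [pred v | (rho v == k) && (0 < abox_row v)%N]).
have ml v : (v \in l) = (rho v == k) && (0 < abox_row v)%N.
  by rewrite mem_sort mem_enum.
have sl : pos_sorted l.
  rewrite /pos_sorted -(@sorted_map _ _ (@pos n gamma) ltn) ltn_sorted_uniq_leq.
  rewrite (map_inj_uniq (@pos_inj n gamma)) sort_uniq enum_uniq /= sorted_map.
  by apply: sort_sorted => v w; apply: leq_total.
have ab : (pos a < pos b)%N by rewrite pos_lt.
have nab : near a b by rewrite /near ab pos_lt_near.
have bl : all (fun v => pos b < pos v)%N l.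
  by apply/allP => v; rewrite ml => /andP[_ v0]; rewrite pos_lt v0.
have sabl : pos_sorted [:: a, b & l].
  by rewrite /pos_sorted /= ab (path_sortedE (@pos_trans n gamma)) bl.
have rl : all (fun v => 0 < abox_row v)%N l.
  by apply/allP => v; rewrite ml => /andP[].
pose delta : K := if ohead l is Some z then (~~ near a z)%:R else 1.
have symd : swap_sym k delta.
  by rewrite /delta; case: (ohead l) => [z|]; [exact: swap_sym_nat | exact: swap_sym1].
(* Stated for every basement with the same merged entries, to serve [tau] and [tau'] with a common
   prefactor. *)
have inner tau1 : (forall c, merge (tau1 c) = merge (tau c)) ->
  \sum_(f | has_basement tau1 f && (skeleton f == rho))
    cst (weight q t f) * monomial F f =
  skeleton_const rho * delta * (pw q t a b (tau1 (abox_col a)) (tau1 (abox_col b)) *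
    transfer q t k b l (tau1 (abox_col b))).
  move=> e; pose f0 : {ffun abox -> 'I_n} :=
    [ffun v => if abox_row v == 0%N then tau1 (abox_col v) else rho v].
  have rb1 v : abox_row v = 0%N -> rho v = merge (tau1 (abox_col v)).
    by rewrite e; apply: rb.
  have ra : rho a = k by rewrite rb // permKV merge_k.
  have rbk : rho b = k by rewrite rb // permKV merge_k'.
  have f0a : f0 a = tau1 (abox_col a) by rewrite ffunE.
  have f0b : f0 b = tau1 (abox_col b) by rewrite ffunE.
  have kb : (f0 b == k) || (f0 b == k') by rewrite f0b -merge_eqk -rb1 ?rbk.
  have ka : (f0 a == k) || (f0 a == k') by rewrite f0a -merge_eqk -rb1 ?ra.
  have al : a \notin l by rewrite ml andbF.
  have bnl : b \notin l by rewrite ml andbF.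
  rewrite -(eq_bigl _ _ (fun f => recoloring_skeleton f rk' rb1 ml)) -/f0.
  transitivity (\sum_(f | recoloring k f0 l f)
     skeleton_const rho * (delta * pw q t a b (f0 a) (f0 b)) *
       chain_weight q t f (b :: l)).
    apply: eq_bigr => f rf; have := rf.
    rewrite recoloring_skeleton // => /andP[_ /eqP sf].
    have mabl v : (v \in [:: a, b & l]) = (rho v == k).
      rewrite !inE ml; have [v0|v0] := posnP (abox_row v); last first.
        rewrite andbT; case: (eqVneq v a) v0 => [->|_ v0] //.
        by case: (eqVneq v b) v0 => [->|_ v0].
      rewrite andbF orbF rb // merge_eqk.
      rewrite !(can2_eq (permK tau) (permKV tau)).
      by congr (_ || _); apply/eqP/eqP => [->|ec] //; apply: abox_eq.
    rewrite (weight_monomial sabl) ?sf //.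
    rewrite (@chain_weight_cons F n q t gamma k k_lt) // => [|v]; last first.
      by rewrite mabl -sf ffunE merge_eqk.
    rewrite (recoloring_mem rf al) (recoloring_mem rf bnl) /xw /= mulr1 -/delta.
    by rewrite !mulrA.
  rewrite -mulr_sumr sum_chain_weight //; last by case/andP: sabl.
  by rewrite /xw /= mul1r f0a f0b !mulrA.
have [A [B [symA symB hk hk']]] :=
  transfer_shape k_lt t_neq0 hook_neq1 (proj2 (andP sabl)) rl.
have ka : tau (abox_col a) = k by rewrite permKV.
have kb : tau (abox_col b) = k' by rewrite permKV.
have ka' : tau' (abox_col a) = k' by rewrite permM ka tpermL.
have kb' : tau' (abox_col b) = k by rewrite permM kb tpermR.
(* The pair [a], [b] is an ascent of weight [t^-1] under [tau] and a descent of weight 1 under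
   [tau']. *)
rewrite !inner // ka kb ka' kb' hk hk' /pw /pair_weight nab /att.
rewrite (negPf k'_neq) eq_sym (negPf k'_neq) kk' ltnSn ltnNge leqnSn /= cst1 mul1r.
apply: T_shape => //; apply: swap_symM => //; exact: skeleton_const_sym.
Qed.

End BasementSwap.

(** * The action of [pi] *)

Section Rotation.

Variables (F : fieldType) (n : nat) (q t : F) (gamma : 'I_n -> nat).
Hypothesis q_neq0 : q != 0.
Local Notation abox := (abox gamma).
Local Notation box := (box gamma).
Implicit Types (c d : 'I_n) (tau : 'S_n) (sigma : filling gamma).

Definition rot_filling sigma : filling gamma := [ffun u => ordS (sigma u)].

Lemma augment_rot tau sigma v :
  augment (tau * rot_perm n)%g (rot_filling sigma) v = ordS (augment tau sigma v).
Proof.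
by rewrite /augment; case: unlift => [j|]; rewrite ?ffunE // permM permE.
Qed.

Lemma nonattacking_rot tau sigma :
  nonattacking (tau * rot_perm n)%g (rot_filling sigma) = nonattacking tau sigma.
Proof.
apply: eq_forallb => v; apply: eq_forallb => w.
by rewrite !augment_rot (inj_eq (@ordS_inj n)).
Qed.

(** Each [chi x y] changes by a difference of indicators at [y] and [x], and these cancel in
    [chi_uv + chi_vw - chi_uw]. *)
Lemma coinvtrip_rot tau sigma :
  coinvtrip (tau * rot_perm n)%g (rot_filling sigma) = coinvtrip tau sigma.
Proof.
apply: eq_card => -[u v]; rewrite !inE /=; congr (_ && (_ == _)).
have chi_rot x y : chi (tau * rot_perm n)%g (rot_filling sigma) x y =
    chi tau sigma x y + ((augment tau sigma y).+1 == n)%:Z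
      - ((augment tau sigma x).+1 == n)%:Z.
  rewrite /chi !augment_rot.
  have := ltn_ordS (augment tau sigma x) (augment tau sigma y); lia.
by rewrite !chi_rot; lia.
Qed.

(** By [ltn_ordS] and [sum_legs], the change in each column reduces to its basement entry and its
    number of entries [n]. Only column [p] has [n] in the basement. *)
Lemma maj_rot tau sigma (p : 'I_n) : (tau p).+1 = n ->
  (maj tau sigma + gamma p = maj (tau * rot_perm n)%g (rot_filling sigma) +
     \sum_(u : box) ((sigma u).+1 == n))%N.
Proof.
move=> top_p; pose f := augment tau sigma; pose top v := ((f v).+1 == n).
have col : (\sum_(u : box) (leg u).+1 * top (down u) + \sum_(u : box) top (up u) =
    gamma p + \sum_(u : box) (leg u).+1 * top (up u))%N.
  (* The default value of [inord] is never met: only rows at most [gamma i] occur. *)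
  pose b i j : nat := top (Tagged (fun i => 'I_(gamma i).+1)
                                  (inord j : 'I_(gamma i).+1)).
  have lE : forall u : box, (leg u).+1 = (gamma (tag u) - tagged u)%N.
    move=> [i j]; rewrite /leg /up /abox_row /= /bump /= add1n.
    by rewrite -subSn ?subSS // (ltn_ord j).
  have dE : forall u : box, top (down u) = b (tag u) (tagged u) :> nat.
    move=> [i j]; congr (nat_of_bool (top (Tagged _ _))); apply: val_inj.
    by rewrite /= inordK // ltnS ltnW // (ltn_ord j).
  have uE : forall u : box, top (up u) = b (tag u) (tagged u).+1 :> nat.
    move=> [i j]; congr (nat_of_bool (top (Tagged _ _))); apply: val_inj.
    by rewrite /= inordK // ltnS (ltn_ord j).
  have -> : gamma p = (\sum_i gamma i * b i 0)%N.
    have b0 i : b i 0%N = ((tau i).+1 == n).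
      by rewrite /b /top /f augment_basement //= /abox_row /= inordK.
    rewrite (bigD1 p) //= b0 top_p eqxx muln1 big1 ?addn0 // => i ip.
    rewrite b0 -[in X in _ == X]top_p eqSS (inj_eq val_inj) (inj_eq perm_inj).
    by rewrite (negPf ip) muln0.
  under eq_bigr do rewrite lE dE; under [X in (_ + X)%N]eq_bigr do rewrite uE.
  under [X in _ = (_ + X)%N]eq_bigr do rewrite lE uE.
  pose c1 i (j : 'I_(gamma i)) := ((gamma i - j) * b i j + b i j.+1)%N.
  pose c2 i (j : 'I_(gamma i)) := ((gamma i - j) * b i j.+1)%N.
  rewrite -big_split /=.
  rewrite -(sig_big_dep xpredT (fun _ => fun=> true) c1).
  rewrite -(sig_big_dep xpredT (fun _ => fun=> true) c2).
  by rewrite -big_split; apply: eq_bigr => i _; rewrite /c1 /c2 /= -sum_legs -big_split.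
have majE tau1 sigma1 : maj tau1 sigma1 = (\sum_(u : box) (leg u).+1 *
    (augment tau1 sigma1 (down u) < augment tau1 sigma1 (up u)))%N.
  by rewrite /maj big_mkcond; apply: eq_bigr => u _; case: ifP; rewrite ?muln1 ?muln0.
have des : (\sum_(u : box) (leg u).+1 * (ordS (f (down u)) < ordS (f (up u))) +
      \sum_(u : box) (leg u).+1 * top (up u) =
    \sum_(u : box) (leg u).+1 * (f (down u) < f (up u)) +
      \sum_(u : box) (leg u).+1 * top (down u))%N.
  by rewrite -!big_split /=; apply: eq_bigr => u _; rewrite -!mulnDr ltn_ordS.
have -> : (\sum_(u : box) ((sigma u).+1 == n) = \sum_(u : box) top (up u))%N.
  by apply: eq_bigr => u _; rewrite /top /f augment_up.
rewrite !majE; under [in RHS]eq_bigr do rewrite !augment_rot.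
by move: col des; rewrite -/f; lia.
Qed.

Lemma expr_balance (a b c d : nat) : (a + b = c + d)%N ->
  q ^+ a * q^-1 ^+ d = q^-1 ^+ b * q ^+ c.
Proof.
move=> e; rewrite !exprVn [RHS]mulrC; apply/eqP.
by rewrite eqr_div ?expf_neq0 // -!exprD e.
Qed.

(** The identity holds term by term: each entry [n] yields one [q^-1] from the substitution, and
    [maj_rot] makes the total power of [q] independent of the filling. *)
Lemma piop_permuted_basement_E tau (p : 'I_n) : (tau p).+1 = n ->
  piop q (of_mpoly (permuted_basement_E q t gamma tau)) =
  cst (q^-1 ^+ gamma p) *
  of_mpoly (permuted_basement_E q t gamma (tau * rot_perm n)%g).
Proof.
move=> top_p.
have pM := rsubst_is_monoid_morphism (@piop_nonvanishing F n q q_neq0).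
have pB := rsubst_is_zmod_morphism (@piop_nonvanishing F n q q_neq0).
pose B1 := GRing.isZmodMorphism.Build _ _ _ pB.
pose B2 := GRing.isMonoidMorphism.Build _ _ _ pM.
pose r : {rmorphism ratfun F n -> ratfun F n} := HB.pack (@piop F n q) B1 B2.
have rc (a : F) : r (cst a) = cst a by apply: piop_cst.
have rv j : r (var j) = (if (j.+1 < n)%N then 1 else cst q^-1) * var (ordS j).
  exact: piop_var.
rewrite -[piop q]/(r : _ -> _); move: r rc rv => r rc rv.
rewrite /permuted_basement_E !raddf_sum mulr_sumr /=.
pose unrot (sigma : filling gamma) : filling gamma := [ffun u => ord_pred (sigma u)].
rewrite [RHS](reindex_onto rot_filling unrot) => [|sigma _]; last first.
  by apply/ffunP => u; rewrite !ffunE ord_predK.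
apply: eq_big => [sigma|sigma _].
  rewrite nonattacking_rot [X in _ && X](_ : _ = true) ?andbT //.
  by apply/eqP/ffunP => u; rewrite !ffunE ordSK.
set R := \prod_(u | _) _; set R' := \prod_(u | augment (_ * _)%g _ _ != _) _.
have <- : R = R' by apply: eq_big => u; rewrite ?augment_rot ?(inj_eq (@ordS_inj n)).
rewrite -!mul_mpolyC [of_mpoly _]rmorphM [of_mpoly (_ * _)]rmorphM rmorphM /=.
rewrite -!/(cst _) rc !rmorph_prod /= coinvtrip_rot.
under [X in _ * X]eq_bigr do rewrite rv.
rewrite big_split /=.
have -> : \prod_u (if ((sigma u).+1 < n)%N then 1 else cst q^-1) =
    cst (q^-1 ^+ \sum_(u : box) ((sigma u).+1 == n)) :> ratfun F n.
  rewrite (big_morph _ (exprD q^-1) (expr0 _)) rmorph_prod /=.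
  apply: eq_bigr => u _; have := ltn_ord (sigma u); rewrite leq_eqVlt.
  by case: eqP => [->|ne]; [rewrite ltnn expr1 | rewrite /= => ->; rewrite expr0 cst1].
rewrite !mulrA -!rmorphM /=; congr (cst _ * _); last first.
  by apply: eq_bigr => u _; rewrite ffunE.
have e := maj_rot sigma top_p; rewrite -[X in X * _]mulrA mulrAC.
by rewrite (expr_balance e) -!mulrA.
Qed.

End Rotation.

Ltac split_ifs := repeat match goal with
  | |- context [if ?b then _ else _] =>
      lazymatch b with
      | context [if _ then _ else _] => fail
      | _ => case: (boolP b) => ? /=
      end
  end.

(** * Tracking the basement through the factors of [Y_i^tau] *)

Section Eigenfunction.

Variables (F : fieldType) (n : nat) (q t : F) (gamma : 'I_n -> nat).
Hypotheses (q_neq0 : q != 0) (t_neq0 : t != 0).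
Hypothesis qt_generic : forall a b : nat, 1 - q ^+ a.+1 * t ^+ b.+1 != 0.
Implicit Types (tau : 'S_n) (i j k : 'I_n).

Let E tau : ratfun F n := of_mpoly (permuted_basement_E q t gamma tau).

Lemma hook_neq1 (w : abox gamma) : 1 - hook q t w * t != 0.
Proof. by rewrite /hook -mulrA -exprSr. Qed.

(** The scalar is the ratio of the two normalizations; being nonzero, it can be inverted for
    [Tinv]. *)
Lemma T_permuted_basement_E tau k : (k.+1 < n)%N ->
  (tau^-1%g k < tau^-1%g (ordS k))%N ->
  exists2 c, c != 0 & T t k (E tau) = cst c * E (tau * tperm k (ordS k))%g.
Proof.
move=> k_lt lt_tau; set tau' := (_ * _)%g.
exists (norm_const t gamma tau / norm_const t gamma tau').
  by rewrite mulf_neq0 ?invr_eq0 ?norm_const_neq0.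
rewrite /E !permuted_basement_E_pair_model // T_cstM T_pair_model //; last first.
  exact: hook_neq1.
by rewrite mulrA -rmorphM /= divfK ?norm_const_neq0.
Qed.

Lemma Tinv_permuted_basement_E tau k : (k.+1 < n)%N ->
  (tau^-1%g (ordS k) < tau^-1%g k)%N ->
  exists2 c, c != 0 & Tinv t k (E tau) = cst c * E (tau * tperm k (ordS k))%g.
Proof.
move=> k_lt gt_tau; set tau' := (_ * _)%g.
have lt_tau' : (tau'^-1%g k < tau'^-1%g (ordS k))%N.
  by rewrite invMg tpermV !permM tpermL tpermR.
have [c c0] := T_permuted_basement_E k_lt lt_tau'.
rewrite -mulgA tperm2 mulg1 => eT.
exists c^-1; first by rewrite invr_eq0.
rewrite -(TK t_neq0 k_lt (cst c^-1 * _)) T_cstM eT mulrA -rmorphM /= mulVf //.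
by rewrite cst1 mul1r.
Qed.

(** The hypothesis says that the sign selects [T_j] exactly when [j] is left of [j+1] in the current
    basement, so one of the two preceding lemmas always applies. *)
Lemma Teps_permuted_basement_E tau tau1 i j c : (j.+1 < n)%N ->
  (eps tau i j == 1) = (tau1^-1%g j < tau1^-1%g (ordS j))%N ->
  exists c', Teps t tau i (cst c * E tau1) j =
             cst c' * E (tau1 * tperm j (ordS j))%g.
Proof.
move=> j_lt e; rewrite /Teps e; case: ltnP => [lt|].
  have [d _ eT] := T_permuted_basement_E j_lt lt.
  by exists (c * d); rewrite T_cstM eT rmorphM mulrA.
rewrite leq_eqVlt => /orP[/eqP/val_inj/perm_inj ee|lt].
  by have := ordS_neq j_lt; rewrite ee eqxx.
have [d _ eT] := Tinv_permuted_basement_E j_lt lt.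
exists (c * d); rewrite rmorphM -mulrA -eT /Tinv T_cstM /=; ring.
Qed.

(* [moved_up i m v] is the entry that replaces [v] in the basement once [i] has
   been carried up to [m] by [T_i, ..., T_(m-1)]; [moved_back i m v] is the one
   after [i] has then been carried to [n-1], rotated to [0] by [pi] and carried
   up again to [m]. *)
Definition moved_up (i m v : nat) : nat :=
  if v == i then m else if (i < v <= m)%N then v.-1 else v.

Definition moved_back (i m v : nat) : nat :=
  if v == i then m else if (m <= v < i)%N then v.+1 else v.

(** The invariant of the folds: the current basement is [tau] relabelled by [phi]. *)
Definition basement_moved tau (phi : nat -> nat) (f : ratfun F n) :=
  exists c tau1, f = cst c * E tau1 /\ forall x, tau1 x = phi (tau x) :> nat.

(** Here [x] and [y] are the columns of the current basement holding [j] and [j+1], so the sign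
    condition becomes a comparison of columns. *)
Lemma moved_step tau tau1 i j (phi phi' : nat -> nat) c (x y : 'I_n) : (j.+1 < n)%N ->
  (forall z, tau1 z = phi (tau z) :> nat) ->
  (forall v, (v < n)%N -> phi' v =
     if phi v == j then j.+1 else if phi v == j.+1 then j : nat else phi v) ->
  phi (tau x) = j -> phi (tau y) = j.+1 ->
  (eps tau i j == 1) = (x < y)%N ->
  basement_moved tau phi' (Teps t tau i (cst c * E tau1) j).
Proof.
move=> j_lt e1 e2 ex ey exy.
have ix : tau1^-1%g j = x.
  by apply: (canLR (permK tau1)); apply: val_inj; rewrite /= e1.
have iy : tau1^-1%g (ordS j) = y.
  by apply: (canLR (permK tau1)); apply: val_inj; rewrite [LHS]val_ordS_lt //= e1.
have [|c' ->] := @Teps_permuted_basement_E tau tau1 i j c j_lt.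
  by rewrite ix iy.
exists c', (tau1 * tperm j (ordS j))%g; split=> // z.
by rewrite permM tperm_val // e1 -e2.
Qed.

Lemma piop_cstM c (f : ratfun F n) : piop q (cst c * f) = cst c * piop q f.
Proof.
have [_ pM] := rsubst_is_monoid_morphism (@piop_nonvanishing F n q q_neq0).
by rewrite -[LHS]/(rsubst _ _) pM; congr (_ * _); apply: piop_cst.
Qed.

Theorem Y_permuted_basement_E tau i : exists c, Y q t tau i (E tau) = cst c * E tau.
Proof.
have iV : tau (tau^-1%g i) = i by rewrite permKV.
have i_lt := ltn_ord i.
rewrite /Y; set l1 := [seq j : 'I_n <- enum 'I_n | (i <= j)%N && (j.+1 < n)%N].
set l2 := [seq j : 'I_n <- enum 'I_n | (j < i)%N].
have el1 : map val l1 = iota i (n.-1 - i).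
  by apply: enum_interval => [|j]; lia.
have el2 : map val l2 = iota 0 i by apply: enum_interval => [|j]; lia.
have sl1 : size l1 = (n.-1 - i)%N by rewrite -(size_map val) el1 size_iota.
have sl2 : size l2 = i by rewrite -(size_map val) el2 size_iota.
set f1 := foldl _ (E tau) l1; set f2 := foldl _ _ l2.
(* At step [j] the original entry [i] has become [j], while [j+1] is still unmoved: the sign tests
   the inversion [(i, j+1)] of [tau]. *)
have P1 : basement_moved tau (moved_up i n.-1) f1.
  have -> : n.-1 = (i + size l1)%N by rewrite sl1; lia.
  apply: (foldl_iota (P := fun m => basement_moved tau (moved_up i m))).
  - by rewrite el1 sl1.
  - exists 1, tau; rewrite cst1 mul1r; split=> // x; rewrite /moved_up.
    by case: eqP => // _; case: ifP => // H; lia.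
  move=> j g; rewrite mem_filter => /andP[/andP[ij j_lt] _] [c [tau1 [-> e1]]].
  have ej := val_ordS_lt j_lt.
  have jV : tau (tau^-1%g (ordS j)) = ordS j by rewrite permKV.
  apply: (@moved_step tau tau1 i j (moved_up i j) _ c (tau^-1%g i)
                      (tau^-1%g (ordS j))) => //.
  - by move=> v v_lt; rewrite /moved_up; split_ifs; lia.
  - by rewrite iV /moved_up eqxx.
  - by rewrite jV ej /moved_up; split_ifs; lia.
  have nij : tau^-1%g i != tau^-1%g (ordS j).
    rewrite (inj_eq perm_inj) -(inj_eq val_inj) -[val (ordS j)]/(nat_of_ord _) ej.
    by rewrite /=; lia.
  move: nij; rewrite -(inj_eq val_inj) /eps ij /inversion ej ltnS ij /=.
  by case: ltngtP.
(* The entry [n] now stands in the column of [i], and the rotation turns it into the smallest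
   entry. *)
have P2 : basement_moved tau (moved_back i 0) (piop q f1).
  have [c [tau1 [-> e1]]] := P1.
  have top : (tau1 (tau^-1%g i)).+1 = n by rewrite e1 iV /moved_up eqxx; lia.
  rewrite piop_cstM (piop_permuted_basement_E _ _ _ top) // mulrA -rmorphM.
  eexists; exists (tau1 * rot_perm n)%g; split; first by reflexivity.
  move=> x; rewrite permM permE val_ordS e1 /moved_up /moved_back.
  by have := ltn_ord (tau x); split_ifs; lia.
(* The rotation raised the entries below [i] by one, so step [j] exchanges the carried entry with
   the original [j], and the sign tests the inversion [(j, i)]. *)
have : basement_moved tau (moved_back i i) f2.
  rewrite -[X in moved_back i X]sl2 -[size l2]add0n.
  apply: (foldl_iota (P := fun m => basement_moved tau (moved_back i m))) => //.
    by rewrite el2 sl2.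
  move=> j g; rewrite mem_filter => /andP[ji _] [c [tau1 [-> e1]]].
  have j_lt : (j.+1 < n)%N by lia.
  have jV : tau (tau^-1%g j) = j by rewrite permKV.
  apply: (@moved_step tau tau1 i j (moved_back i j) _ c (tau^-1%g i)
                      (tau^-1%g j)) => //.
  - by move=> v v_lt; rewrite /moved_back; split_ifs; lia.
  - by rewrite iV /moved_back eqxx.
  - by rewrite jV /moved_back; split_ifs; lia.
  by rewrite /eps leqNgt ji /inversion ji /=; case: ltnP.
(* [moved_back i i] is the identity: its shifted range is empty. *)
case=> c [tau1 [-> e1]]; have -> : tau1 = tau.
  apply/permP => x; apply: val_inj; rewrite /= e1 /moved_back.
  by case: eqP => // _; case: ifP => // H; lia.
by eexists; rewrite mulrA -rmorphM; reflexivity.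
Qed.

End Eigenfunction.

(** * Specialization to the field [Q(q, t)] *)

Lemma gen_neq1 (a b : nat) : 1 - q_gen ^+ a.+1 * t_gen ^+ b.+1 != 0.
Proof.
rewrite subr_eq0 eq_sym /q_gen /t_gen /var -!rmorphXn -rmorphM /=.
rewrite -(rmorph1 (@of_mpoly rat 2)) (inj_eq (@of_mpoly_inj rat 2)).
(* Both exponents are positive, so setting the indeterminates to 0 turns the assumed equality into
   [1 = 0]. *)
apply/eqP => /(congr1 (meval (fun _ => 0))).
by rewrite rmorphM !rmorphXn /= !mevalXU rmorph1 expr0n mul0r => /eqP;
   rewrite eq_sym oner_eq0.
Qed.

Theorem proposition4p4p8 (n : nat) (hn : (3 <= n)%N) (gamma : 'I_n -> nat)
    (tau : 'S_n) (i : 'I_n) :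
  exists c : Qqt,
    Y q_gen t_gen tau i (of_mpoly (permuted_basement_E q_gen t_gen gamma tau))
    = cst c * of_mpoly (permuted_basement_E q_gen t_gen gamma tau).
Proof.
exact: (Y_permuted_basement_E _ q_gen_neq0 t_gen_neq0 gen_neq1).
Qed.
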